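(* Let $\rho_n(x)$ denote the density of the random point field with kernel $K_n$ at the point $x\in\mathbb{R}^3$ with respect to the Lebesgue measure on $\mathbb{R}^3$. Let $u$ be a pure unit quaternion and $s\in\mathbb{R}$, $s>0$. Then $$\lim_{n\to\infty}2\sqrt n\,\rho_n\bigl(2\sqrt n\,us\bigr)=\begin{cases}\rho(s), & \text{if } s<1,\\ 0, & \text{if } s>1,\end{cases}$$ where $\rho(s)=\dfrac{1}{(2\pi)^2}\dfrac{\sqrt{1-s^2}}{s^2}$ for $s\in(0,1)$.
   Context: $\mathbb{H}$ denotes the real quaternions; $\Lambda\subset\mathbb{H}$ is the set of pure (imaginary) quaternions $z=x_1\mathbf i+x_2\mathbf j+x_3\mathbf k$, identified with $\mathbb{R}^3$. The background measure on $\Lambda$ is $d\mu(z)=f(z)\,dm(z)$, $f(z)=(2\pi)^{-3/2}e^{-|z|^2/2}$, with $m$ Lebesgue measure on $\mathbb{R}^3$. Polynomials are functions on $\Lambda$ of the form $P(z)=\sum_{k=0}^N z^ka_k$, $a_k\in\mathbb{H}$, with scalar product $\langle u,w\rangle=\int_\Lambda \overline{u(z)}w(z)\,d\mu(z)$. $P_n$ ($n\ge0$) denotes the (unique) system of monic polynomials (leading term $z^n$) with $\langle P_k,P_l\rangle=0$ for $k\ne l$, and $h_n=\langle P_n,P_n\rangle$. The kernel is $K_n(x,y)=\sum_{k=0}^{n}P_k(x)\overline{P_k(y)}/h_k$. The point field with kernel $K_n$ is the random point field on $\Lambda$ whose $k$-point correlation functions with respect to $\mu$ are $\mathrm{Det}_M[K_n(x_i,x_j)]_{1\le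 i,j\le k}$, where $\mathrm{Det}_M$ is the Dyson–Moore determinant of a self-dual quaternion matrix (the product of its real right eigenvalues). Its one-point correlation function with respect to $\mu$ is $K_n(x,x)$, so its density with respect to Lebesgue measure is $\rho_n(x)=K_n(x,x)f(x)$. *)

(* Defs.v *)
From HB Require Import structures.
From mathcomp Require Import all_boot all_order all_algebra.
From mathcomp Require Import all_classical all_reals all_analysis.
From mathcomp Require Import ring lra.
Set Implicit Arguments.
Unset Strict Implicit.
Unset Printing Implicit Defensive.
Import Order.TTheory GRing.Theory Num.Theory.
Import numFieldNormedType.Exports.
Local Open Scope classical_set_scope.
Local Open Scope ring_scope.

Record quat (R : Type) := Quat { qre : R; qi : R; qj : R; qk : R }.
Arguments Quat {R}.
Arguments qre {R}.
Arguments qi {R}.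
Arguments qj {R}.
Arguments qk {R}.

Section QuaternionRing.
Context {R : realType}.
Implicit Types x y z : quat R.

Definition tuple_of_quat x := (qre x, qi x, qj x, qk x).
Definition quat_of_tuple (t : R * R * R * R) :=
  let: (a, b, c, d) := t in Quat a b c d.
Lemma tuple_of_quatK : cancel tuple_of_quat quat_of_tuple.
Proof. by case. Qed.
HB.instance Definition _ := Choice.copy (quat R) (can_type tuple_of_quatK).

Definition qzero : quat R := Quat 0 0 0 0.
Definition qone : quat R := Quat 1 0 0 0.
Definition qadd x y :=
  Quat (qre x + qre y) (qi x + qi y) (qj x + qj y) (qk x + qk y).
Definition qopp x := Quat (- qre x) (- qi x) (- qj x) (- qk x).
Definition qmul x y :=
  Quat (qre x * qre y - qi x * qi y - qj x * qj y - qk x * qk y)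
       (qre x * qi y + qi x * qre y + qj x * qk y - qk x * qj y)
       (qre x * qj y - qi x * qk y + qj x * qre y + qk x * qi y)
       (qre x * qk y + qi x * qj y - qj x * qi y + qk x * qre y).
Definition qscale (a : R) x := Quat (a * qre x) (a * qi x) (a * qj x) (a * qk x).

Lemma qaddA : associative qadd.
Proof. by move=> [? ? ? ?] [? ? ? ?] [? ? ? ?]; rewrite /qadd /= !addrA. Qed.
Lemma qaddC : commutative qadd.
Proof.
move=> [a b c d] [a' b' c' d'].
by rewrite /qadd /= (addrC a) (addrC b) (addrC c) (addrC d).
Qed.
Lemma qadd0 : left_id qzero qadd.
Proof. by move=> [? ? ? ?]; rewrite /qadd /= !add0r. Qed.
Lemma qaddN : left_inverse qzero qopp qadd.
Proof. by move=> [? ? ? ?]; rewrite /qadd /= !addNr. Qed.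
HB.instance Definition _ :=
  GRing.isZmodule.Build (quat R) qaddA qaddC qadd0 qaddN.

Lemma qmulA : associative qmul.
Proof. by move=> [? ? ? ?] [? ? ? ?] [? ? ? ?]; congr Quat => /=; ring. Qed.
Lemma qmul1x : left_id qone qmul.
Proof. by move=> [? ? ? ?]; congr Quat => /=; ring. Qed.
Lemma qmulx1 : right_id qone qmul.
Proof. by move=> [? ? ? ?]; congr Quat => /=; ring. Qed.
Lemma qmulDl : left_distributive qmul (@GRing.add (quat R)).
Proof. by move=> [? ? ? ?] [? ? ? ?] [? ? ? ?]; congr Quat => /=; ring. Qed.
Lemma qmulDr : right_distributive qmul (@GRing.add (quat R)).
Proof. by move=> [? ? ? ?] [? ? ? ?] [? ? ? ?]; congr Quat => /=; ring. Qed.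
Lemma qone_neq0 : qone != 0 :> quat R.
Proof. by apply/eqP => -[]; apply/eqP; exact: oner_neq0. Qed.
HB.instance Definition _ := GRing.Zmodule_isNzRing.Build (quat R)
  qmulA qmul1x qmulx1 qmulDl qmulDr qone_neq0.

Lemma qscaleA a b x : qscale a (qscale b x) = qscale (a * b) x.
Proof. by case: x => *; congr Quat => /=; ring. Qed.
Lemma qscale1 : left_id 1 qscale.
Proof. by case=> *; congr Quat => /=; ring. Qed.
Lemma qscaleDr : right_distributive qscale (@GRing.add (quat R)).
Proof. by move=> a [? ? ? ?] [? ? ? ?]; congr Quat => /=; ring. Qed.
Lemma qscaleDl x : {morph qscale^~ x : a b / a + b}.
Proof. by case: x => ? ? ? ? a b; congr Quat => /=; ring. Qed.
HB.instance Definition _ := GRing.Zmodule_isLmodule.Build R (quat R)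
  qscaleA qscale1 qscaleDr qscaleDl.

Definition qconj x : quat R := Quat (qre x) (- qi x) (- qj x) (- qk x).
Definition qnorm x : R :=
  Num.sqrt (qre x ^+ 2 + qi x ^+ 2 + qj x ^+ 2 + qk x ^+ 2).
Definition qinv x : quat R := (qnorm x ^+ 2)^-1 *: qconj x.

Lemma qnorm2 x :
  qnorm x ^+ 2 = qre x ^+ 2 + qi x ^+ 2 + qj x ^+ 2 + qk x ^+ 2.
Proof. by rewrite sqr_sqrtr// !addr_ge0// sqr_ge0. Qed.

Lemma qnorm2_eq0 x : (qnorm x ^+ 2 == 0) = (x == 0).
Proof.
rewrite qnorm2; apply/eqP/eqP => [|->]; last by rewrite /= expr0n/= !addr0.
case: x => a b c d /= /eqP.
rewrite !paddr_eq0 ?addr_ge0 ?sqr_ge0// !sqrf_eq0.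
by move=> /andP[/andP[/andP[/eqP-> /eqP->] /eqP->] /eqP->].
Qed.

Lemma qmulVx : {in predC1 0, left_inverse (1 : quat R) qinv *%R}.
Proof.
move=> x; rewrite inE -qnorm2_eq0 /qinv qnorm2.
by case: x => a b c d /= nz; congr Quat => /=; field.
Qed.
Lemma qmulxV : {in predC1 0, right_inverse (1 : quat R) qinv *%R}.
Proof.
move=> x; rewrite inE -qnorm2_eq0 /qinv qnorm2.
by case: x => a b c d /= nz; congr Quat => /=; field.
Qed.
Lemma quat_unitP x y : y * x = 1 /\ x * y = 1 -> x \in predC1 0.
Proof.
move=> [yx _]; apply/eqP => x0; move: yx; rewrite x0 mulr0 => /esym/eqP.
by rewrite oner_eq0.
Qed.
Lemma qinv_out : {in [predC predC1 (0 : quat R)], qinv =1 id}.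
Proof. by move=> x; rewrite !inE negbK => /eqP->; congr Quat => /=; ring. Qed.
HB.instance Definition _ := GRing.NzRing_hasMulInverse.Build (quat R)
  qmulVx qmulxV quat_unitP qinv_out.

End QuaternionRing.

Section QuaternionPointField.
Context {R : realType}.
Implicit Types (x y z : quat R) (p : {poly quat R}) (P : nat -> {poly quat R}).

Definition pure_of_R3 (v : R * R * R) : quat R := Quat 0 v.1.1 v.1.2 v.2.

Definition leb3 := ((@lebesgue_measure R \x @lebesgue_measure R) \x
  @lebesgue_measure R)%E.

Definition gauss z : R := (2 * pi) `^ (- (3 / 2)) * expR (- (qnorm z ^+ 2 / 2)).

(* Integral of g over the pure quaternions with respect to d mu = gauss dm. *)
Definition int_mu (g : quat R -> R) : R :=
  \int[leb3]_v (g (pure_of_R3 v) * gauss (pure_of_R3 v)).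

Definition qint_mu (g : quat R -> quat R) : quat R :=
  Quat (int_mu (qre \o g)) (int_mu (qi \o g))
       (int_mu (qj \o g)) (int_mu (qk \o g)).

Definition qdot (g h : quat R -> quat R) : quat R :=
  qint_mu (fun z => qconj (g z) * h z).

(* Evaluation with the coefficients on the right, sum_k z^k a_k; it differs
   from p.[z], which puts them on the left. *)
Definition peval p z : quat R := \sum_(k < size p) z ^+ k * p`_k.

Definition monic_orthogonal P : Prop :=
  (forall n, P n \is monic /\ size (P n) = n.+1) /\
  (forall k l, k != l -> qdot (peval (P k)) (peval (P l)) = 0).

Definition hnorm P n : quat R := qdot (peval (P n)) (peval (P n)).

Definition kernel P n x y : quat R :=
  \sum_(k < n.+1) peval (P k) x * qconj (peval (P k) y) / hnorm P k.

Definition qreal (a : R) : quat R := Quat a 0 0 0.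

(* d is the product, with multiplicity, of the right eigenvalues of A, all of
   them real: the columns of the invertible matrix U are right eigenvectors,
   A v_j = v_j lam_j. *)
Definition real_eigenvalue_product k (A : 'M[quat R]_k) (d : R) : Prop :=
  exists (U V : 'M[quat R]_k) (lam : 'rV[R]_k),
    [/\ U *m V = 1%:M, V *m U = 1%:M,
        A *m U = U *m diag_mx (map_mx qreal lam) & d = \prod_j lam 0 j].

(* The Dyson-Moore determinant of a self-dual matrix (equal to its conjugate
   transpose); such a matrix has a basis of right eigenvectors with real
   eigenvalues, so that the value 0 is a default for other matrices only. *)
Definition moore_det k (A : 'M[quat R]_k) : R :=
  xget 0 [set d | real_eigenvalue_product A d].

Lemma moore_det_1x1 (A : 'M[quat R]_1) (a : R) :
  A 0 0 = qreal a -> moore_det A = a.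
Proof.
move=> Aa; rewrite /moore_det; apply: xget_unique.
  exists 1%:M, 1%:M, (\row_j a); split; rewrite ?mulmx1 ?mul1mx//.
    apply/matrixP => i j; rewrite !ord1 Aa !mxE eqxx mulr1n //.
  by rewrite big_ord1 mxE.
move=> b [U [V [l [UV VU AU ->]]]]; rewrite big_ord1.
have := congr1 (fun (M : 'M[quat R]_1) => M 0 0) AU; have := congr1 (fun (M : 'M[quat R]_1) => M 0 0) UV.
rewrite !mxE !big_ord1 !mxE Aa eqxx mulr1n => uv h.
have : U 0 0 != 0 by apply/eqP => z; move: uv; rewrite z mul0r => /esym/eqP; rewrite oner_eq0.
have e : qreal a * U 0 0 = U 0 0 * qreal a.
  by case: (U 0 0) => *; congr Quat => /=; ring.
move=> nz; have : U 0 0 \is a GRing.unit by [].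
move=> /mulrI inj; move: h; rewrite e => /inj; rewrite /map_mx; by case.
Qed.

(* k-point correlation functions, with respect to mu and to the Lebesgue
   measure, of the point field with kernel K. *)
Definition correlation_mu (K : quat R -> quat R -> quat R) k
    (x : 'I_k -> quat R) : R :=
  moore_det (\matrix_(i < k, j < k) K (x i) (x j)).

Definition correlation_leb (K : quat R -> quat R -> quat R) k
    (x : 'I_k -> quat R) : R :=
  correlation_mu K x * \prod_(i < k) gauss (x i).

Definition point_field_density (K : quat R -> quat R -> quat R) x : R :=
  correlation_leb K (fun _ : 'I_1 => x).

Definition rho P n x : R := point_field_density (kernel P n) x.

Definition limit_density (s : R) : R :=
  1 / (2 * pi) ^+ 2 * (Num.sqrt (1 - s ^+ 2) / s ^+ 2).

End QuaternionPointField.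

(* Main.v *)
(** Write [r = |z|].  Since [z^2 = - r^2] on pure quaternions, the orthogonal
    polynomials have real coefficients, and [P_n (r u) = u^n p_n(r)] where [p_n]
    is the monic orthogonal polynomial on the line for the weight
    [x^2 exp(-x^2/2)].  These are combinations of Hermite polynomials [He_k],
    which gives [r^2 K_n(r u, r u) = \sum_(k <= n+1) He_k(r)^2 / k!] up to a
    relative error [O(1/r)].  By Christoffel-Darboux the Hermite sum is, up to a
    factor, the energy [y'^2 + (n + 1 - x^2/4) y^2] of the Hermite function
    [y = He_n exp(-x^2/4)].  As [y'' = - Q y] with [Q = n + 1/2 - x^2/4], the
    quantity [(y'^2 + Q y^2) / sqrt Q] is an adiabatic invariant, so that the sum
    at [x] is its value at [0], given by Wallis' formula, times
    [sqrt (Q(x) / Q(0))].  Beyond the turning point ([s > 1]) the sum is bounded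
    by the one of a larger index [N ~ nu n] with [nu] slightly above [s^2]. *)
Require Import Defs.
From HB Require Import structures.
From mathcomp Require Import all_boot all_order all_algebra.
From mathcomp Require Import all_classical all_reals all_analysis.
From mathcomp Require Import measurable_realfun.
From mathcomp Require Import ring lra zify.
Import Order.TTheory GRing.Theory Num.Theory.
Import numFieldNormedType.Exports.
Set Implicit Arguments.
Unset Strict Implicit.
Unset Printing Implicit Defensive.
Local Open Scope classical_set_scope.
Local Open Scope ring_scope.

(** * Derivatives of real functions *)

(** Noncommutativity disappears at the level of moments: the integral of [z ^+ n] is real, so
    orthogonality concerns a single scalar moment functional, which is handled algebraically through
    recurrence coefficients. Working with the Hermite sum avoids oscillatory asymptotics: it is a
    positive quadratic form in [y] and [y'], insensitive to the phase, and no asymptotics of an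
    individual polynomial is needed. The obstacle is that the adiabatic invariant is not constant to
    first order. With [a ^+ 2 = n + 1/2], its logarithmic derivative has order [1 / a] on an
    interval of length of order [a]. The leading part is however a slowly varying coefficient times
    the derivative of [y * y']; subtracting the corresponding product leaves a rate of order
    $a^{-3}$, hence a total error of order $1/n$. This needs [Q] to stay above a fixed fraction of
    [a ^+ 2], so the turning point is out of reach and the case [s > 1] relies on monotonicity in
    the index. The estimates concern squares of the energy and of the sums; square roots are taken
    only in the last limits. *)

Section RealDerivatives.
Context {R : realType}.
Implicit Types (f g : R -> R) (x a b : R).

(* [is_derive] is a class whose instances mangle the shape of derivatives; this
   alias keeps derivative computations out of instance resolution. *)
Definition has_deriv f x a : Prop := is_derive x (1 : R) f a.

Lemma has_deriv_cst c x : has_deriv (fun _ => c) x 0.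
Proof. exact: is_derive_cst. Qed.

Lemma has_deriv_id x : has_deriv (fun y => y) x 1.
Proof. exact: is_derive_id. Qed.

Lemma has_derivD f g x a b : has_deriv f x a -> has_deriv g x b ->
  has_deriv (fun y => f y + g y) x (a + b).
Proof. by move=> hf hg; exact: is_deriveD. Qed.

Lemma has_derivN f x a : has_deriv f x a -> has_deriv (fun y => - f y) x (- a).
Proof. by move=> hf; exact: is_deriveN. Qed.

Lemma has_derivM f g x a b : has_deriv f x a -> has_deriv g x b ->
  has_deriv (fun y => f y * g y) x (a * g x + f x * b).
Proof.
move=> hf hg; apply: (is_derive_eq (is_deriveM hf hg)).
by rewrite /GRing.scale/= addrC mulrC.
Qed.

Lemma has_derivX f x a n : has_deriv f x a ->
  has_deriv (fun y => f y ^+ n) x (n%:R * f x ^+ n.-1 * a).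
Proof.
by move=> hf; rewrite /has_deriv -exprfctE; exact: (is_deriveX n hf).
Qed.

Lemma has_derivV f x a : f x != 0 -> has_deriv f x a ->
  has_deriv (fun y => (f y)^-1) x (- f x ^- 2 * a).
Proof. by move=> f0 hf; exact: (is_deriveV f0 hf). Qed.

Lemma has_deriv_expR f x a : has_deriv f x a ->
  has_deriv (fun y => expR (f y)) x (expR (f x) * a).
Proof. by move=> hf; exact: (is_derive1_comp (is_derive_expR (f x)) hf). Qed.

Lemma has_deriv_eq f x a b : has_deriv f x a -> a = b -> has_deriv f x b.
Proof. by move=> ? <-. Qed.

Lemma has_deriv_derivable f x a : has_deriv f x a -> derivable f x 1.
Proof. by case. Qed.

Lemma has_deriv_derive1 f x a : has_deriv f x a -> derive1 f x = a.
Proof. by move=> hf; rewrite derive1E; exact: (@derive_val _ _ _ _ _ _ _ hf). Qed.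

Lemma has_deriv_continuous f x a : has_deriv f x a -> {for x, continuous f}.
Proof. by case=> /derivable1_diffP/differentiable_continuous. Qed.

Lemma has_deriv_nondecreasing f df a b :
  (forall x, a <= x <= b -> has_deriv f x (df x)) ->
  (forall x, a <= x <= b -> 0 <= df x) -> a <= b -> f a <= f b.
Proof.
move=> fd d0; rewrite le_eqVlt => /predU1P[->//|ab].
have [||c] := @MVT _ f df _ _ ab.
- by move=> x; rewrite in_itv/= => /andP[/ltW ax /ltW xb]; apply: fd; rewrite ax.
- apply: derivable_within_continuous => x; rewrite in_itv/= => xab.
  exact: has_deriv_derivable (fd x xab).
rewrite in_itv/= => /andP[/ltW ac /ltW cb]; rewrite -subr_ge0 => ->.
by rewrite mulr_ge0 ?d0 ?ac// subr_ge0 ltW.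
Qed.

End RealDerivatives.

(** An inverse is tried as a constant first, so that numerals such as [2^-1] create no nonvanishing
    condition. *)
Ltac derive_step := lazymatch goal with
  | |- has_deriv (fun y => y) _ _ => exact: has_deriv_id
  | |- has_deriv (fun y => @?f y + @?g y) _ _ => apply: (has_derivD (f := f) (g := g))
  | |- has_deriv (fun y => - @?f y) _ _ => apply: (has_derivN (f := f))
  | |- has_deriv (fun y => @?f y * @?g y) _ _ => apply: (has_derivM (f := f) (g := g))
  | |- has_deriv (fun y => @?f y ^+ _) _ _ => apply: (has_derivX (f := f))
  | |- has_deriv (fun y => (@?f y)^-1) _ _ =>
      first [exact: has_deriv_cst | apply: (has_derivV (f := f))]
  | |- has_deriv (fun y => expR (@?f y)) _ _ => apply: (has_deriv_expR (f := f))
  | |- _ => exact: has_deriv_cst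
  end.
Ltac derive_all := apply: has_deriv_eq; [repeat derive_step | ].

(** * Gaussian moments and Wallis bounds *)

Lemma integrableZ_EFin d (T : measurableType d) (R : realType)
    (mu : {measure set T -> \bar R}) (D : set T) (f : T -> R) (c : R) :
  measurable D -> mu.-integrable D (EFin \o f) ->
  mu.-integrable D (EFin \o (fun x => c * f x)).
Proof. by move=> mD fi; exact: (integrableZl mD c fi). Qed.

Lemma integrableB_EFin d (T : measurableType d) (R : realType)
    (mu : {measure set T -> \bar R}) (D : set T) (f g : T -> R) :
  measurable D -> mu.-integrable D (EFin \o f) -> mu.-integrable D (EFin \o g) ->
  mu.-integrable D (EFin \o (fun x => f x - g x)).
Proof. by move=> mD fi gi; exact: (integrableB mD fi gi). Qed.

Section GaussianMoments.
Context {R : realType}.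
Implicit Types (x : R) (k n : nat).
Notation leb := (@lebesgue_measure R).

Definition phi x : R := (Num.sqrt (2 * pi))^-1 * expR (- x ^+ 2 / 2).

Lemma phi_gt0 x : 0 < phi x.
Proof. by rewrite mulr_gt0 ?expR_gt0// invr_gt0 sqrtr_gt0 mulr_gt0 ?pi_gt0. Qed.

Lemma phi0 : phi 0 = (Num.sqrt (2 * pi))^-1.
Proof. by rewrite /phi expr0n/= oppr0 mul0r expR0 mulr1. Qed.

Lemma phiE : phi = normal_pdf 0 1 :> (R -> R).
Proof.
apply/funext => x; rewrite normal_pdfE ?oner_neq0// /phi /normal_peak /normal_fun.
by rewrite expr1n mul1r subr0 mulr_natl.
Qed.

Lemma has_deriv_phi x : has_deriv phi x (- x * phi x).
Proof.
rewrite /phi; set c := (Num.sqrt _)^-1.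
derive_all; rewrite /=. by field.
Qed.

Lemma has_deriv_pow_phi k x :
  has_deriv (fun y => y ^+ k * phi y) x (k%:R * x ^+ k.-1 * phi x - x ^+ k.+1 * phi x).
Proof.
apply: has_deriv_eq; first exact: has_derivM (has_derivX k (has_deriv_id x)) (has_deriv_phi x).
by rewrite /= exprS; ring.
Qed.

Lemma continuous_pow_phi k : continuous (fun y : R => y ^+ k * phi y).
Proof. by move=> x; exact: has_deriv_continuous (has_deriv_pow_phi k x). Qed.

(** The integral of [x ^+ k * phi x] over the half line, generated by integration by parts. On the
    half line the odd orders do not vanish, and Wallis' bounds need them. *)
Fixpoint half_moment k : R :=
  match k with
  | 0 => 2^-1
  | 1 => phi 0
  | k'.+2 => k'.+1%:R * half_moment k'
  end.

Lemma cvg_pow_phi k : (n%:R ^+ k * phi n%:R) @[n --> \oo] --> (0 : R).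
Proof.
(* From $e^t \ge t^{k+1}/(k+1)!$ at $t = n^2/2$, together with $n^k (n+1) \le 2 n^{2(k+1)}$. *)
pose C : R := (Num.sqrt (2 * pi))^-1 * (2 * 2 ^+ k.+1 * (k.+1)`!%:R).
have C0 : C * harmonic n @[n --> \oo] --> (0 : R).
  by rewrite -[0](mulr0 C); apply: cvgMr; exact: cvg_harmonic.
apply: (squeeze_cvgr _ (cvg_cst _) C0).
near=> n.
have n1 : 1 <= n%:R :> R by rewrite ler1n; near: n; exact: nbhs_infty_gt.
have n0 : 0 < n%:R :> R by rewrite (lt_le_trans _ n1).
apply/andP; split; first by rewrite mulr_ge0 ?exprn_ge0 ?(ltW (phi_gt0 _))// ltW.
rewrite /phi mulrCA /C -(mulrA _ (2 * _ * _) _). rewrite ler_wpM2l ?invr_ge0 ?sqrtr_ge0//.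
rewrite /harmonic ler_pdivlMr ?ltr0Sn// mulNr expRN mulrAC ler_pdivrMr ?expR_gt0//.
have h := expR_ge1Dxn k (divr_ge0 (sqr_ge0 n%:R) (ltW (ltr0n R 2))).
have {}h := le_trans (ler_wpDl ler01 (lexx _)) h.
rewrite ler_pdivrMr ?ltr0n ?fact_gt0// expr_div_n in h.
rewrite ler_pdivrMr ?exprn_gt0// in h.
have : n%:R ^+ k * n.+1%:R <= 2 * n%:R ^+ 2 ^+ k.+1 :> R.
  apply: (@le_trans _ _ (2 * n%:R ^+ k.+1)).
    have : 0 <= n%:R ^+ k :> R by rewrite exprn_ge0// ltW.
    rewrite -natr1 exprS; nra.
  rewrite ler_wpM2l// -exprM ler_weXn2l//. 
  by rewrite leq_pmull.
lra.
Unshelve. all: by end_near. Qed.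

Lemma integrable_pow_phi_itv k (a b : R) :
  leb.-integrable `[a, b] (EFin \o (fun x => x ^+ k * phi x)).
Proof.
apply: continuous_compact_integrable; first exact: segment_compact.
exact/continuous_subspaceT/continuous_pow_phi.
Qed.

Lemma FTC2_itv0 (F f : R -> R) n : (0 < n)%N ->
  (forall x, has_deriv F x (f x)) -> continuous f ->
  \int[leb]_(x in `[0, n%:R]) f x = F n%:R - F 0.
Proof.
move=> n0 Fd fc; rewrite /Rintegral (@continuous_FTC2 _ f F)//.
- by rewrite ltr0n.
- exact: continuous_subspaceT.
- split.
  + by move=> x _; exact: has_deriv_derivable (Fd x).
  + by apply: cvg_at_right_filter; exact: has_deriv_continuous (Fd _).
  + by apply: cvg_at_left_filter; exact: has_deriv_continuous (Fd _).
- by move=> x _; exact: has_deriv_derive1 (Fd x).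
Qed.

(** Integration by parts: the fundamental theorem is applied to [x ^+ k.+1 * phi x], whose boundary
    value at 0 vanishes. *)
Lemma Rintegral_pow_phi_rec k n : (0 < n)%N ->
  \int[leb]_(x in `[0, n%:R]) (x ^+ k.+2 * phi x) =
  k.+1%:R * \int[leb]_(x in `[0, n%:R]) (x ^+ k * phi x) - n%:R ^+ k.+1 * phi n%:R.
Proof.
move=> n0.
have cF : continuous (fun x : R => k.+1%:R * (x ^+ k * phi x) - x ^+ k.+2 * phi x).
  move=> x; apply: cvgB; last exact: continuous_pow_phi.
  by apply: cvgMr; exact: continuous_pow_phi.
have Fd x : has_deriv (fun y => y ^+ k.+1 * phi y) x
    (k.+1%:R * (x ^+ k * phi x) - x ^+ k.+2 * phi x).
  by apply: has_deriv_eq; [exact: has_deriv_pow_phi|rewrite mulrA].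
have := FTC2_itv0 n0 Fd cF.
rewrite RintegralB//; last 2 first.
- by apply: integrableZ_EFin => //; exact: integrable_pow_phi_itv.
- exact: integrable_pow_phi_itv.
rewrite RintegralZl//; last exact: integrable_pow_phi_itv.
rewrite [0 ^+ _]exprS !mul0r subr0 => <-; ring.
Qed.

Lemma integral_phi_ge0 : (\int[leb]_(x in `[0%R, +oo[) (phi x)%:E = (2^-1)%:E)%E.
Proof.
have := @integral_normal_pdf R 0 1; rewrite -phiE.
rewrite ge0_symfun_integralT; last 3 first.
- by move=> x; rewrite ltW ?phi_gt0.
- by move=> x; exact: has_deriv_continuous (has_deriv_phi x).
- by move=> x; rewrite /phi /= sqrrN.
rewrite (_ : [set x | _] = `[0, +oo[%classic); last first.
  by apply/seteqP; split => x/=; rewrite in_itv/= andbT.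
case: (integral _ _ _) => [r| |].
- by rewrite -EFinM => -[h]; congr EFin; lra.
- by rewrite mulry gtr0_sg// mul1e.
- by rewrite mulrNy gtr0_sg// mul1e.
Qed.

(** The recursion has step two, hence two starting points: half the total mass at order 0, the
    primitive [- phi] at order 1. *)
Lemma cvg_Rintegral_pow_phi k :
  \int[leb]_(x in `[0, n%:R]) (x ^+ k * phi x) @[n --> \oo] --> half_moment k.
Proof.
have [m] := ubnP k; elim: m k => // m IH [|[|k]] km.
- rewrite /=; under eq_fun do under eq_Rintegral do rewrite expr0 mul1r.
  have mphi : measurable_fun setT phi by rewrite phiE; exact: measurable_normal_pdf.
  have := @ge0_cvgn_integral R leb phi (fun x => ltW (phi_gt0 x)) mphi.
  by rewrite integral_phi_ge0 => /fine_cvg.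
- rewrite /=.
  have h : phi 0 - n%:R ^+ 0 * phi n%:R @[n --> \oo] --> phi 0.
    rewrite -[X in _ --> X]subr0; apply: cvgB; first exact: cvg_cst.
    exact: cvg_pow_phi.
  apply: cvg_trans h; apply: near_eq_cvg; near=> n.
  rewrite (@FTC2_itv0 (fun y => - phi y)).
  + by rewrite expr0; ring.
  + by near: n; exact: nbhs_infty_gt.
  + by move=> x; apply: has_deriv_eq; [apply: has_derivN; exact: has_deriv_phi|rewrite expr1; ring].
  + exact: continuous_pow_phi.
- rewrite /=.
  have h : k.+1%:R * \int[leb]_(x in `[0, n%:R]) (x ^+ k * phi x) - n%:R ^+ k.+1 * phi n%:R
     @[n --> \oo] --> k.+1%:R * half_moment k.
    rewrite -[X in _ --> X]subr0; apply: cvgB; last exact: cvg_pow_phi.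
    by apply: cvgMr; apply: IH; rewrite -ltnS ltnW.
  apply: cvg_trans h; apply: near_eq_cvg; near=> n.
  by rewrite Rintegral_pow_phi_rec//; near: n; exact: nbhs_infty_gt.
Unshelve. all: by end_near. Qed.

Lemma half_moment_gt0 k : 0 < half_moment k.
Proof.
have [m] := ubnP k; elim: m k => // m IH [|[|k]] km /=.
- by rewrite invr_gt0.
- exact: phi_gt0.
- by rewrite mulr_gt0// IH// -ltnS ltnW.
Qed.

(* The discriminant of [t |-> \int_0^oo (x - t)^2 x^k phi(x) dx] is nonpositive. *)
Lemma half_moment_logconvex k :
  half_moment k.+1 ^+ 2 <= half_moment k * half_moment k.+2.
Proof.
have quad t : 0 <= half_moment k.+2 - 2 * t * half_moment k.+1 + t ^+ 2 * half_moment k.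
  have h : \int[leb]_(x in `[0, n%:R]) (x ^+ k.+2 * phi x)
     - 2 * t * \int[leb]_(x in `[0, n%:R]) (x ^+ k.+1 * phi x)
     + t ^+ 2 * \int[leb]_(x in `[0, n%:R]) (x ^+ k * phi x) @[n --> \oo]
     --> half_moment k.+2 - 2 * t * half_moment k.+1 + t ^+ 2 * half_moment k.
    apply: cvgD; last by apply: cvgMr; exact: cvg_Rintegral_pow_phi.
    apply: cvgB; first exact: cvg_Rintegral_pow_phi.
    by apply: cvgMr; exact: cvg_Rintegral_pow_phi.
  rewrite -(cvg_lim _ h)//; apply: limr_ge; first by apply/cvg_ex; eexists; exact: h.
  near=> n.
  rewrite -!RintegralZl ?integrable_pow_phi_itv//.
  rewrite -RintegralB//; last 2 first.
  - exact: integrable_pow_phi_itv.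
  - by apply: integrableZ_EFin => //; exact: integrable_pow_phi_itv.
  rewrite -RintegralD//; last 2 first.
  - apply: integrableB_EFin => //; first exact: integrable_pow_phi_itv.
    by apply: integrableZ_EFin => //; exact: integrable_pow_phi_itv.
  - by apply: integrableZ_EFin => //; exact: integrable_pow_phi_itv.
  apply: Rintegral_ge0 => x /=; rewrite in_itv/= => /andP[x0 _].
  rewrite (_ : _ + _ = (x - t) ^+ 2 * (x ^+ k * phi x)).
    by rewrite mulr_ge0 ?sqr_ge0// mulr_ge0 ?exprn_ge0 ?(ltW (phi_gt0 _)).
  by rewrite !exprS; ring.
have m0 := half_moment_gt0 k.
rewrite -subr_ge0.
(* The quadratic is evaluated at its minimiser [half_moment k.+1 / half_moment k]. *)
have -> : half_moment k * half_moment k.+2 - half_moment k.+1 ^+ 2 =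
    half_moment k * (half_moment k.+2
      - 2 * (half_moment k.+1 / half_moment k) * half_moment k.+1
      + (half_moment k.+1 / half_moment k) ^+ 2 * half_moment k).
  by field; rewrite gt_eqF.
by rewrite mulr_ge0 ?quad// ltW.
Unshelve. all: by end_near. Qed.

Lemma measurable_pow_phi k : measurable_fun [set: R] (fun x => x ^+ k * phi x).
Proof.
 by apply: continuous_measurable_fun; exact: continuous_pow_phi. Qed.

Lemma integral_norm_pow_phi_ge0 k :
  (\int[leb]_(x in `[0%R, +oo[) `|x ^+ k * phi x|%:E = (half_moment k)%:E)%E.
Proof.
have mh : measurable_fun [set: R] (fun x => `|x ^+ k * phi x|).
  by apply: measurableT_comp => //; exact: measurable_pow_phi.
have h1 := @ge0_cvgn_integral R leb _ (fun x => normr_ge0 (x ^+ k * phi x)) mh.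
rewrite -(cvg_lim _ h1)//; apply: cvg_lim => //.
(* [fine] sends infinite values to 0; a nonzero limit of the real values rules these out. *)
apply/neq0_fine_cvgP; first by rewrite gt_eqF ?half_moment_gt0.
apply: cvg_trans (@cvg_Rintegral_pow_phi k); apply: near_eq_cvg; near=> n.
apply: eq_Rintegral => x; rewrite inE/= in_itv/= => /andP[x0 _].
by rewrite ger0_norm// mulr_ge0 ?exprn_ge0 ?(ltW (phi_gt0 _)).
Unshelve. all: by end_near. Qed.

Definition moment k : R := if odd k then 0 else 2 * half_moment k.

Lemma integral_norm_pow_phi k :
  (\int[leb]_x `|x ^+ k * phi x|%:E = (2 * half_moment k)%:E)%E.
Proof.
rewrite ge0_symfun_integralT; last 3 first.
- by move=> x; exact: normr_ge0.
- by move=> x; apply: cvg_norm; exact: continuous_pow_phi.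
- by move=> x; rewrite /= !normrM !normrX normrN /phi sqrrN.
rewrite (_ : [set x | _] = `[0, +oo[%classic); last first.
  by apply/seteqP; split => x/=; rewrite in_itv/= andbT.
by rewrite integral_norm_pow_phi_ge0.
Qed.

Lemma integrable_pow_phi k :
  leb.-integrable setT (EFin \o (fun x => x ^+ k * phi x)).
Proof.
apply/integrableP; split; first by apply/measurable_EFinP; exact: measurable_pow_phi.
by rewrite /= integral_norm_pow_phi ltry.
Qed.

(* For odd [k] the integrand [f] satisfies [f + |f| = 2 f 1_(x >= 0)]. *)
Lemma integral_pow_phi k :
  (\int[leb]_x (x ^+ k * phi x)%:E = (moment k)%:E)%E.
Proof.
rewrite /moment; case: ifPn => [ok|ek]; last first.
  rewrite -integral_norm_pow_phi; apply: eq_integral => x _.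
  by rewrite ger0_norm// mulr_ge0 ?(ltW (phi_gt0 _))// exprn_even_ge0.
pose f x : R := x ^+ k * phi x.
have inf := integrable_pow_phi k.
have inh : leb.-integrable setT (EFin \o (fun x => `|f x|)).
  exact: integrable_norm.
have ing : leb.-integrable setT (EFin \o (fun x => f x + `|f x|)).
  exact: (integrableD measurableT inf inh).
transitivity (\int[leb]_x ((f x + `|f x|)%:E - `|f x|%:E))%E.
  by apply: eq_integral => x _; rewrite -EFinB addrK.
rewrite (integralB_EFin _ ing inh)//= integral_norm_pow_phi.
suff -> : (\int[leb]_x (f x + `|f x|)%:E = (2 * half_moment k)%:E)%E.
  by rewrite -EFinB subrr.
rewrite [RHS]EFinM -integral_norm_pow_phi_ge0 -ge0_integralZl//; last first.
  apply/measurable_EFinP; apply: measurable_funS measurableT _ _ => //.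
  by apply: measurableT_comp => //; exact: measurable_pow_phi.
rewrite [RHS]integral_mkcond; apply: eq_integral => x _.
rewrite patchE mem_setE in_itv/= andbT.
have p0 := phi_gt0 x.
case: leP => x0.
  by rewrite -EFinM ger0_norm ?mulr_ge0 ?exprn_ge0 ?(ltW p0)// /f; congr EFin; ring.
rewrite ler0_norm ?subrr// pmulr_lle0//.
by rewrite exprn_odd_le0// ltW.
Qed.

Lemma moment0 : moment 0 = 1.
Proof. by rewrite /moment/= divff. Qed.

Lemma moment_odd k : odd k -> moment k = 0.
Proof. by rewrite /moment => ->. Qed.

Lemma moment_rec k : moment k.+2 = k.+1%:R * moment k.
Proof. by rewrite /moment/= negbK; case: ifP => _; rewrite ?mulr0// mulrCA. Qed.

(** This is $\binom{2m}{m}/4^m$, which is also $He_{2m}(0)^2/(2m)!$. *)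
Definition central_binomial_ratio m : R := \prod_(j < m) ((2 * j + 1)%:R / (2 * j + 2)%:R).

(** Ties the Wallis product to the moments, whose log-convexity controls it. The factor [2 * phi 0]
    normalises the ratio to 1 at [m = 0]. *)
Lemma half_moment_ratio m :
  half_moment (2 * m) / half_moment (2 * m + 1) * (2 * phi 0) = central_binomial_ratio m.
Proof.
have p0 : phi 0 != 0 by rewrite gt_eqF ?phi_gt0.
elim: m => [|m IH].
  by rewrite /central_binomial_ratio big_ord0/=; field.
have -> : half_moment (2 * m.+1) = (2 * m + 1)%:R * half_moment (2 * m).
  by rewrite mulnS -[(2 + 2 * m)%N]/((2 * m).+2) /= addn1.
have -> : half_moment (2 * m.+1 + 1) = (2 * m + 2)%:R * half_moment (2 * m + 1).
  by rewrite mulnS -[(2 + 2 * m)%N]/((2 * m).+2) addn1 /= addn1 addn2.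
rewrite /central_binomial_ratio big_ord_recr/= -/(central_binomial_ratio m) -IH.
have h : half_moment (2 * m + 1) != 0 by rewrite gt_eqF ?half_moment_gt0.
have h2 : (2 * m + 2)%:R != 0 :> R by rewrite pnatr_eq0 addn2.
move: (_ + 2)%:R (_ + 1)%:R h2 => c d c0.
by field; rewrite h c0.
Qed.

(** With A and B the half moments of orders 2m and 2m + 1, log-convexity from the orders 2m and 2m -
    1 gives $2m A^2 \le B^2 \le (2m+1) A^2$; moreover $(2\phi(0))^2 = 2/\pi$. *)
Lemma wallis m : (0 < m)%N ->
  2 / (pi * (2 * m + 1)%:R) <= central_binomial_ratio m ^+ 2 <= 2 / (pi * (2 * m)%:R).
Proof.
move=> m0; rewrite -half_moment_ratio.
have pi0 := pi_gt0 R.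
have -> : (half_moment (2 * m) / half_moment (2 * m + 1) * (2 * phi 0)) ^+ 2 =
   (half_moment (2 * m) / half_moment (2 * m + 1)) ^+ 2 * (2 / pi).
  rewrite [LHS]exprMn [(2 * _) ^+ 2]exprMn phi0 exprVn sqr_sqrtr ?mulr_ge0 ?(ltW pi0)//.
  by congr (_ * _); move: (@pi R) pi0 => p p0; field; rewrite gt_eqF.
have A0 := half_moment_gt0 (2 * m).
have B0 := half_moment_gt0 (2 * m + 1).
have h1 : half_moment (2 * m + 1) ^+ 2 <= (2 * m + 1)%:R * half_moment (2 * m) ^+ 2.
  rewrite expr2 mulrCA addn1; exact: half_moment_logconvex.
have h2 : (2 * m)%:R * half_moment (2 * m) ^+ 2 <= half_moment (2 * m + 1) ^+ 2.
  have : half_moment (2 * m).-1.+1 ^+ 2 <= half_moment (2 * m).-1 * half_moment (2 * m).-1.+2.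
    exact: half_moment_logconvex.
  have -> : half_moment (2 * m + 1) = (2 * m)%:R * half_moment (2 * m).-1.
    by rewrite -[in LHS](@prednK (2 * m)) ?muln_gt0// addn1 /= prednK ?muln_gt0.
  have -> : half_moment (2 * m).-1.+2 = (2 * m)%:R * half_moment (2 * m).-1.
    by rewrite /= prednK ?muln_gt0.
  rewrite prednK ?muln_gt0// => h.
  by rewrite [leRHS]expr2 -mulrA ler_wpM2l.
rewrite expr_div_n.
have B20 : 0 < half_moment (2 * m + 1) ^+ 2 by rewrite exprn_gt0.
have m20 : 0 < (2 * m)%:R :> R by rewrite ltr0n muln_gt0.
have m210 : 0 < (2 * m + 1)%:R :> R by rewrite ltr0n addn1.
have pi20 : 0 <= 2 / pi :> R by rewrite divr_ge0// ltW.
have e (c : R) : 2 / (pi * c) = 2 / pi / c by rewrite invfM mulrA.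
rewrite !e.
have -> (c : R) : c * (2 / pi) = 2 / pi * c by rewrite mulrC.
apply/andP; split; apply: ler_wpM2l => //.
- by rewrite ler_pdivlMr// mulrC ler_pdivrMr// mulrC.
- by rewrite ler_pdivrMr// mulrC ler_pdivlMr// mulrC.
Qed.

End GaussianMoments.

(** * Gaussian integrals on the pure quaternions *)

Section ProductIntegral.
Context d1 d2 (T1 : measurableType d1) (T2 : measurableType d2) (R : realType).
Variables (m1 : {sigma_finite_measure set T1 -> \bar R})
  (m2 : {sigma_finite_measure set T2 -> \bar R}).
Variables (f : T1 -> R) (g : T2 -> R).
Hypotheses (fi : m1.-integrable setT (EFin \o f))
  (gi : m2.-integrable setT (EFin \o g)).

Lemma integrable_prodM :
  (m1 \x m2)%E.-integrable setT (EFin \o (fun z => f z.1 * g z.2)).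
Proof.
have mf : measurable_fun setT f by apply/measurable_EFinP; exact: measurable_int fi.
have mg : measurable_fun setT g by apply/measurable_EFinP; exact: measurable_int gi.
have mfg : measurable_fun setT (EFin \o (fun z : T1 * T2 => f z.1 * g z.2)).
  apply/measurable_EFinP; apply: measurable_funM.
    exact: (measurableT_comp mf measurable_fst).
  exact: (measurableT_comp mg measurable_snd).
apply/(integrable12ltyP _ _ mfg).
rewrite (eq_integral (fun x => `|f x|%:E * \int[m2]_y `|g y|%:E)%E); last first.
  move=> x _; rewrite -ge0_integralZl//; last first.
    by apply/measurable_EFinP; exact: measurableT_comp.
  by apply: eq_integral => y _; rewrite /= normrM EFinM.
rewrite ge0_integralZr//.
- apply: lte_mul_pinfty.
  + exact: integral_ge0.
  + rewrite ge0_fin_numE ?integral_ge0//; by have /integrableP[] := fi.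
  + by have /integrableP[] := gi.
- by apply/measurable_EFinP; exact: measurableT_comp.
- exact: integral_ge0.
Qed.

Lemma Rintegral_prodM : \int[(m1 \x m2)%E]_z (f z.1 * g z.2) =
  (\int[m1]_x f x) * (\int[m2]_y g y).
Proof.
rewrite /Rintegral -integral12_prod_meas1; last exact: integrable_prodM.
set G := fine (\int[m2]_y (g y)%:E).
have GE : (\int[m2]_y (g y)%:E = G%:E)%E.
  by rewrite /G fineK//; exact: integrable_fin_num.
have ffin : (\int[m1]_x (f x)%:E)%E \is a fin_num by exact: integrable_fin_num.
have e x : fubini_F m2 (fun z => (f z.1 * g z.2)%:E) x = ((f x)%:E * G%:E)%E.
  rewrite -GE -(integralZl measurableT gi).
  by apply: eq_integral => y _.
transitivity (fine (\int[m1]_x ((f x)%:E * G%:E))%E).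
  by congr fine; apply: eq_integral => x _; exact: e.
by rewrite integralZr// fineM.
Qed.

End ProductIntegral.

(* [product_measure1] only carries its sigma-finite structure for factors that
   are subprobabilities, hence this alias. *)
Definition leb2 (R : realType) := (@lebesgue_measure R \x @lebesgue_measure R)%E.

Section SigmaFiniteLeb2.
Context {R : realType}.
Notation leb := (@lebesgue_measure R).

HB.instance Definition _ := Measure.copy (@leb2 R) (leb \x leb)%E.

Let leb2_sigma_finite : sigma_finite setT (@leb2 R).
Proof.
have /sigma_finiteP[F [TF ndF Foo]] := sigma_finiteT leb.
exists (fun n => F n `*` F n).
  apply/esym/seteqP; split => // -[x y] _.
  have [n _ Fx] : (\bigcup_i F i) x by rewrite -TF.
  have [k _ Fy] : (\bigcup_i F i) y by rewrite -TF.
  exists (maxn n k) => //; split.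
  - exact: (subsetPset _ _ (ndF _ _ (leq_maxl n k))).
  - exact: (subsetPset _ _ (ndF _ _ (leq_maxr n k))).
move=> n; have [mF Fn] := Foo n; split; first exact: measurableX.
rewrite /leb2 [X in (X < _)%E](product_measure1E leb leb mF mF).
by rewrite lte_mul_pinfty ?measure_ge0// ge0_fin_numE ?measure_ge0.
Qed.

HB.instance Definition _ :=
  Measure_isSigmaFinite.Build _ _ _ (@leb2 R) leb2_sigma_finite.

End SigmaFiniteLeb2.

Section Gauss3.
Context {R : realType}.
Notation leb := (@lebesgue_measure R).

Lemma powR_2pi : (2 * pi) `^ (- (3 / 2)) = (Num.sqrt (2 * pi))^-1 ^+ 3 :> R.
Proof.
have p2 : 0 < 2 * pi :> R by rewrite mulr_gt0 ?pi_gt0.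
rewrite powRN exprVn; congr (_^-1).
rewrite -powR12_sqrt ?(ltW p2)// -powR_mulrn ?powR_ge0// -powRrM.
by congr (_ `^ _); field.
Qed.

Lemma gauss_pure (v : R * R * R) :
  gauss (pure_of_R3 v) = phi v.1.1 * phi v.1.2 * phi v.2.
Proof.
rewrite /gauss qnorm2 /= expr0n/= add0r /phi powR_2pi.
have -> : expR (- ((v.1.1 ^+ 2 + v.1.2 ^+ 2 + v.2 ^+ 2) / 2)) =
   expR (- v.1.1 ^+ 2 / 2) * expR (- v.1.2 ^+ 2 / 2) * expR (- v.2 ^+ 2 / 2).
  by rewrite -!expRD; congr expR; field.
by move: (_^-1) => c; ring.
Qed.

(** Integrability travels with the value because additivity of the integral requires it; the rules
    below then chain without side conditions. *)
Definition has_int (g : quat R -> R) (c : R) : Prop :=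
  leb3.-integrable setT (EFin \o (fun v => g (pure_of_R3 v) * gauss (pure_of_R3 v)))
  /\ int_mu g = c.

Lemma has_int_monomial a b c :
  has_int (fun z => qi z ^+ a * qj z ^+ b * qk z ^+ c) (moment a * moment b * moment c).
Proof.
have mI k : \int[leb]_x (x ^+ k * phi x) = moment k.
  by rewrite /Rintegral integral_pow_phi.
have e (v : R * R * R) : qi (pure_of_R3 v) ^+ a * qj (pure_of_R3 v) ^+ b *
    qk (pure_of_R3 v) ^+ c * gauss (pure_of_R3 v) =
    (v.1.1 ^+ a * phi v.1.1 * (v.1.2 ^+ b * phi v.1.2)) * (v.2 ^+ c * phi v.2).
  by rewrite gauss_pure /=; ring.
have pI k := @integrable_pow_phi R k.
have i2 := integrable_prodM (pI a) (pI b).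
have i3 := @integrable_prodM _ _ _ _ R (@leb2 R) leb _ _ i2 (pI c).
split.
  apply: eq_integrable i3 => // v _ /=; congr EFin; exact/esym/e.
rewrite /int_mu. under eq_Rintegral do rewrite e.
rewrite (@Rintegral_prodM _ _ _ _ R (@leb2 R) leb _ _ i2 (pI c)) mI.
by rewrite (Rintegral_prodM (pI a) (pI b)) !mI.
Qed.

Lemma has_intD f g a b : has_int f a -> has_int g b ->
  has_int (fun z => f z + g z) (a + b).
Proof.
move=> [fi <-] [gi <-]; split.
  under [in X in _.-integrable _ X]eq_fun do rewrite mulrDl.
  exact: (integrableD measurableT fi gi).
rewrite /int_mu; under eq_Rintegral do rewrite mulrDl.
by rewrite RintegralD.
Qed.

Lemma has_intZ f a c : has_int f a -> has_int (fun z => c * f z) (c * a).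
Proof.
move=> [fi <-]; split.
  under [in X in _.-integrable _ X]eq_fun do rewrite -mulrA.
  exact: integrableZ_EFin.
rewrite /int_mu; under eq_Rintegral do rewrite -mulrA.
by rewrite RintegralZl.
Qed.

Lemma has_int_eq f g a : (forall v, f (pure_of_R3 v) = g (pure_of_R3 v)) ->
  has_int f a -> has_int g a.
Proof.
move=> fg [fi <-]; split.
  by apply: eq_integrable fi => // v _ /=; rewrite fg.
by apply: eq_Rintegral => v _; rewrite fg.
Qed.

Lemma has_int0 : has_int (fun _ => 0) 0.
Proof.
apply: (has_int_eq (f := fun z => 0 * (qi z ^+ 0 * qj z ^+ 0 * qk z ^+ 0))).
  by move=> v; rewrite mul0r.
by rewrite -[X in has_int _ X](mul0r (moment 0 * moment 0 * moment 0));
  apply: has_intZ; exact: has_int_monomial.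
Qed.

(** The integral of $|z|^{2m} x_1^a x_2^b x_3^c$, one factor $|z|^2$ being expanded at each step.
    The inductions on [m] need the exponents to be free. *)
Fixpoint rmoment m a b c : R :=
  match m with
  | 0 => moment a * moment b * moment c
  | m'.+1 => rmoment m' a.+2 b c + rmoment m' a b.+2 c + rmoment m' a b c.+2
  end.

Lemma has_int_radial m a b c :
  has_int (fun z => (qi z ^+ 2 + qj z ^+ 2 + qk z ^+ 2) ^+ m *
    (qi z ^+ a * qj z ^+ b * qk z ^+ c)) (rmoment m a b c).
Proof.
elim: m a b c => [|m IH] a b c.
  by apply: has_int_eq (has_int_monomial a b c) => v; rewrite expr0 mul1r.
have := has_intD (has_intD (IH a.+2 b c) (IH a b.+2 c)) (IH a b c.+2).
by apply: has_int_eq => v; rewrite !exprS; ring.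
Qed.

(** In polar coordinates, with $d = 2m + a + b + c$: the integral of $r^{d+4} e^{-r^2/2}$ is $d + 3$
    times that of $r^{d+2} e^{-r^2/2}$. The induction uses only the one-dimensional recursion. *)
Lemma rmoment_rec m a b c :
  rmoment m.+1 a b c = (2 * m + 3 + a + b + c)%:R * rmoment m a b c.
Proof.
elim: m a b c => [|m IH] a b c.
  by rewrite /rmoment !moment_rec -!natr1 !natrD; ring.
rewrite -[LHS]/(rmoment m.+1 a.+2 b c + rmoment m.+1 a b.+2 c + rmoment m.+1 a b c.+2).
have -> : rmoment m.+1 a b c = rmoment m a.+2 b c + rmoment m a b.+2 c + rmoment m a b c.+2 by [].
by rewrite !IH !natrD !natrM -!natr1; ring.
Qed.

Lemma rmoment_odd m a b c : [|| odd a, odd b | odd c] -> rmoment m a b c = 0.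
Proof.
elim: m a b c => [|m IH] a b c o; last by rewrite /= !IH ?addr0//= ?negbK.
by case/or3P: o => o /=; rewrite (moment_odd o) ?mulr0 ?mul0r.
Qed.

End Gauss3.

(** * Quaternion-valued integrals *)

Section QuaternionFacts.
Context {R : realType}.
Implicit Types (x y z u : quat R) (p q : {poly quat R}).

Lemma quat_eqP x y : qre x = qre y -> qi x = qi y -> qj x = qj y -> qk x = qk y -> x = y.
Proof. by case: x => ? ? ? ?; case: y => ? ? ? ? /= -> -> -> ->. Qed.

Ltac quat_ring := apply: quat_eqP; rewrite /=; ring.

Lemma qreal_zmod_morphism : zmod_morphism (@qreal R).
Proof. by move=> a b; quat_ring. Qed.
Lemma qreal_monoid_morphism : monoid_morphism (@qreal R).
Proof. by split=> [|a b]; quat_ring. Qed.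
HB.instance Definition _ := GRing.isZmodMorphism.Build R (quat R) (@qreal R) qreal_zmod_morphism.
HB.instance Definition _ := GRing.isMonoidMorphism.Build R (quat R) (@qreal R) qreal_monoid_morphism.

Lemma qreal_comm a x : qreal a * x = x * qreal a.
Proof. by quat_ring. Qed.

Lemma scale_qreal a x : a *: x = qreal a * x.
Proof. by quat_ring. Qed.

Lemma qconjM x y : qconj (x * y) = qconj y * qconj x.
Proof. by quat_ring. Qed.

Lemma qconjD x y : qconj (x + y) = qconj x + qconj y.
Proof. by quat_ring. Qed.

Lemma qconj0 : qconj 0 = 0 :> quat R.
Proof. by quat_ring. Qed.

Lemma qconj_qreal a : qconj (qreal a) = qreal a :> quat R.
Proof. by quat_ring. Qed.

Lemma qconj_sum I (r : seq I) (F : I -> quat R) :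
  qconj (\sum_(i <- r) F i) = \sum_(i <- r) qconj (F i).
Proof. by elim/big_rec2: _ => [|i a b _ <-]; rewrite ?qconj0 ?qconjD. Qed.

Lemma qconj_mul_self x : qconj x * x = qreal (qnorm x ^+ 2).
Proof. by rewrite qnorm2; quat_ring. Qed.

Lemma mul_qconj_self x : x * qconj x = qreal (qnorm x ^+ 2).
Proof. by rewrite qnorm2; quat_ring. Qed.

Lemma pure_conj x : qre x = 0 -> qconj x = - x.
Proof. by case: x => a b c d /= ->; quat_ring. Qed.

Lemma pure_sqr x : qre x = 0 -> x * x = qreal (- qnorm x ^+ 2).
Proof.
move=> x0; have := qconj_mul_self x; rewrite pure_conj// mulNr => /(congr1 -%R).
by rewrite opprK -rmorphN.
Qed.

Lemma pure_conjX x n : qre x = 0 -> qconj (x ^+ n) = qreal ((-1) ^+ n) * x ^+ n.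
Proof.
move=> x0; elim: n => [|n IH]; first by rewrite !expr0 rmorph1 mul1r; quat_ring.
rewrite exprSr qconjM IH pure_conj// mulNr !exprS rmorphM rmorphN1 mulN1r !mulNr.
by rewrite mulrA -qreal_comm -mulrA -exprS -exprSr exprS.
Qed.

(** Real coefficients are central, so left and right evaluation agree. *)
Lemma peval_real (H : {poly R}) z : peval (map_poly qreal H) z = (map_poly qreal H).[z].
Proof.
rewrite /peval horner_coef; apply: eq_bigr => i _.
by rewrite coef_map -qreal_comm.
Qed.

Lemma sum_poly_widen (V : zmodType) (A : nzRingType) (p : {poly A}) n (F : A -> nat -> V) :
  (forall i, F 0 i = 0) -> (size p <= n)%N ->
  \sum_(i < size p) F p`_i i = \sum_(i < n) F p`_i i.
Proof.
move=> F0 pn; rewrite (big_ord_widen n (fun i => F p`_i i) pn).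
rewrite [RHS](bigID (fun i : 'I_n => (i < size p)%N))/=.
rewrite [X in _ = _ + X]big1 ?addr0// => i; rewrite -leqNgt => h.
by rewrite nth_default.
Qed.

Definition has_qint (g : quat R -> quat R) (c : quat R) : Prop :=
  [/\ has_int (qre \o g) (qre c), has_int (qi \o g) (qi c),
      has_int (qj \o g) (qj c) & has_int (qk \o g) (qk c)].

Lemma has_qint_val g c : has_qint g c -> qint_mu g = c.
Proof. by case=> -[_ a] [_ b] [_ d] [_ e]; apply: quat_eqP. Qed.

Lemma has_qint_eq f g c : (forall v, f (pure_of_R3 v) = g (pure_of_R3 v)) ->
  has_qint f c -> has_qint g c.
Proof.
by move=> fg [a b d e]; split; [apply: has_int_eq a|apply: has_int_eq b|
  apply: has_int_eq d|apply: has_int_eq e] => v /=; rewrite fg.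
Qed.

Lemma has_qintD f g a b : has_qint f a -> has_qint g b ->
  has_qint (fun z => f z + g z) (a + b).
Proof. by move=> [? ? ? ?] [? ? ? ?]; split; apply: has_intD. Qed.

Lemma has_qint0 : has_qint (fun _ => 0) 0.
Proof. by split; apply: has_int0. Qed.

Lemma has_qint_sum I (r : seq I) (F : I -> quat R -> quat R) (c : I -> quat R) :
  (forall i, has_qint (F i) (c i)) ->
  has_qint (fun z => \sum_(i <- r) F i z) (\sum_(i <- r) c i).
Proof.
move=> h; elim: r => [|i r IH].
  by rewrite big_nil; apply: has_qint_eq has_qint0 => v; rewrite big_nil.
rewrite big_cons; apply: has_qint_eq (has_qintD (h i) IH) => v.
by rewrite big_cons.
Qed.

(** Each component of a product with a constant quaternion is a combination of this shape. *)
Lemma has_int_lin4 f1 f2 f3 f4 (a1 a2 a3 a4 c1 c2 c3 c4 : R) :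
  has_int f1 c1 -> has_int f2 c2 -> has_int f3 c3 -> has_int f4 c4 ->
  has_int (fun z => a1 * f1 z + a2 * f2 z + a3 * f3 z + a4 * f4 z)
    (a1 * c1 + a2 * c2 + a3 * c3 + a4 * c4).
Proof. by move=> *; do ?apply: has_intD; apply: has_intZ. Qed.

Lemma has_qintMl x g c : has_qint g c -> has_qint (fun z => x * g z) (x * c).
Proof.
case: x => a b d e [h1 h2 h3 h4]; split => /=.
- have := has_int_lin4 a (- b) (- d) (- e) h1 h2 h3 h4.
  by rewrite !mulNr; apply: has_int_eq => v /=; ring.
- have := has_int_lin4 b a (- e) d h1 h2 h3 h4.
  rewrite (_ : a * _ + _ + _ - _ = b * qre c + a * qi c + - e * qj c + d * qk c); last by ring.
  by apply: has_int_eq => v /=; ring.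
- have := has_int_lin4 d e a (- b) h1 h2 h3 h4.
  rewrite (_ : a * _ - _ + _ + _ = d * qre c + e * qi c + a * qj c + - b * qk c); last by ring.
  by apply: has_int_eq => v /=; ring.
- have := has_int_lin4 e (- d) b a h1 h2 h3 h4.
  rewrite (_ : a * _ + _ - _ + _ = e * qre c + - d * qi c + b * qj c + a * qk c); last by ring.
  by apply: has_int_eq => v /=; ring.
Qed.

Lemma has_qintMr x g c : has_qint g c -> has_qint (fun z => g z * x) (c * x).
Proof.
case: x => a b d e [h1 h2 h3 h4]; split => /=.
- have := has_int_lin4 a (- b) (- d) (- e) h1 h2 h3 h4.
  rewrite (_ : _ * a - _ - _ - _ = a * qre c + - b * qi c + - d * qj c + - e * qk c); last by ring.
  by apply: has_int_eq => v /=; ring.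
- have := has_int_lin4 b a e (- d) h1 h2 h3 h4.
  rewrite (_ : qre c * b + _ + _ - _ = b * qre c + a * qi c + e * qj c + - d * qk c); last by ring.
  by apply: has_int_eq => v /=; ring.
- have := has_int_lin4 d (- e) a b h1 h2 h3 h4.
  rewrite (_ : qre c * d - _ + _ + _ = d * qre c + - e * qi c + a * qj c + b * qk c); last by ring.
  by apply: has_int_eq => v /=; ring.
- have := has_int_lin4 e d (- b) a h1 h2 h3 h4.
  rewrite (_ : qre c * e + _ - _ + _ = e * qre c + d * qi c + - b * qj c + a * qk c); last by ring.
  by apply: has_int_eq => v /=; ring.
Qed.

(** The integral of [z ^+ n]: as $z^{2m} = (-1)^m |z|^{2m}$ it equals $(-1)^m (2m+1)!!$ for n = 2m,
    and odd powers cancel by symmetry. These are the moments of $ix$ when x has density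
    [x ^+ 2 * phi x]. *)
Fixpoint qmoment n : R :=
  match n with
  | 0 => 1
  | 1 => 0
  | n'.+2 => - (n' + 3)%:R * qmoment n'
  end.

Lemma qmoment_odd n : odd n -> qmoment n = 0.
Proof.
have [m] := ubnP n; elim: m n => // m IH [|[|n]]//= nm; rewrite negbK => o.
by rewrite IH ?mulr0// -ltnS ltnW.
Qed.

Lemma qmoment_even m : qmoment m.*2 = (-1) ^+ m * rmoment m 0 0 0.
Proof.
elim: m => [|m IH]; first by rewrite expr0 mul1r /= moment0 !mulr1.
rewrite doubleS rmoment_rec /= IH !addn0 -muln2 mulnC exprS; ring.
Qed.

Lemma has_qintX n : has_qint (fun z => z ^+ n) (qreal (qmoment n)).
Proof.
have e m (v : R * R * R) : pure_of_R3 v ^+ m.*2 =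
    qreal ((-1) ^+ m * (v.1.1 ^+ 2 + v.1.2 ^+ 2 + v.2 ^+ 2) ^+ m).
  rewrite -muln2 mulnC exprM expr2 pure_sqr// qnorm2 -rmorphXn; congr (qreal _).
  rewrite [LHS]exprNn. by congr (_ * _); rewrite /= expr0n/= add0r.
rewrite -(odd_double_half n); case: (odd n); rewrite ?add1n ?add0n; last first.
  rewrite qmoment_even.
  have h := has_intZ ((-1) ^+ n./2) (@has_int_radial R n./2 0 0 0).
  split => /=; last 3 first.
  - by apply: has_int_eq has_int0 => v /=; rewrite e.
  - by apply: has_int_eq has_int0 => v /=; rewrite e.
  - by apply: has_int_eq has_int0 => v /=; rewrite e.
  by apply: has_int_eq h => v /=; rewrite e /= !expr0 !mulr1.
rewrite qmoment_odd//=; last by rewrite odd_double.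
have e1 m (v : R * R * R) : pure_of_R3 v ^+ m.*2.+1 = pure_of_R3 v *
    qreal ((-1) ^+ m * (v.1.1 ^+ 2 + v.1.2 ^+ 2 + v.2 ^+ 2) ^+ m).
  by rewrite exprS e.
split => /=.
- by apply: has_int_eq has_int0 => v; rewrite /comp e1 /=; ring.
- have := has_intZ ((-1) ^+ n./2) (@has_int_radial R n./2 1 0 0).
  rewrite rmoment_odd// mulr0; apply: has_int_eq => v.
  by rewrite /comp e1 /= !expr0 expr1; ring.
- have := has_intZ ((-1) ^+ n./2) (@has_int_radial R n./2 0 1 0).
  rewrite rmoment_odd// mulr0; apply: has_int_eq => v.
  by rewrite /comp e1 /= !expr0 expr1; ring.
- have := has_intZ ((-1) ^+ n./2) (@has_int_radial R n./2 0 0 1).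
  rewrite rmoment_odd// mulr0; apply: has_int_eq => v.
  by rewrite /comp e1 /= !expr0 expr1; ring.
Qed.

(** Conjugation sends $z^k$ to $(-1)^k z^k$ for pure z, so the Gram matrix of the powers is real and
    only the coefficients fail to commute. *)
Lemma qdot_peval p q : qdot (peval p) (peval q) =
  \sum_(k < size p) \sum_(l < size q)
    qconj p`_k * qreal ((-1) ^+ k * qmoment (k + l)) * q`_l.
Proof.
apply: has_qint_val.
have h (k : 'I_(size p)) (l : 'I_(size q)) := has_qintMr q`_l
  (has_qintMl (qconj p`_k * qreal ((-1) ^+ k)) (has_qintX (k + l))).
have := has_qint_sum (index_enum 'I_(size p))
  (fun k => has_qint_sum (index_enum 'I_(size q)) (h k)).
under eq_bigr do under eq_bigr do rewrite -(mulrA (qconj _)) -rmorphM.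
apply: has_qint_eq => v.
rewrite /peval qconj_sum big_distrl/=; apply: eq_bigr => k _.
rewrite big_distrr/=; apply: eq_bigr => l _.
by rewrite qconjM pure_conjX// exprD !mulrA.
Qed.

End QuaternionFacts.

(** * The quaternionic orthogonal polynomials *)

Section OrthogonalPolynomials.
Context {R : realType}.
Implicit Types (p q : {poly quat R}) (P : nat -> {poly quat R}).
Local Arguments qmoment : simpl never.

(* Recurrence coefficients of the monic orthogonal polynomials [gherm] for the
   weight [x^2 exp(-x^2/2)] on the line; [qherm n] is [i^n gherm (z / i) n]. *)
Definition ghbeta k : R := (if odd k then k.+2 else k)%:R.

Fixpoint qherm n : {poly R} :=
  match n with
  | 0 => 1
  | n'.+1 => match n' with
             | 0 => 'X
             | m.+1 => qherm n' * 'X + ghbeta n' *: qherm m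
             end
  end.

Fixpoint gherm (x : R) n : R :=
  match n with
  | 0 => 1
  | n'.+1 => match n' with
             | 0 => x
             | m.+1 => gherm x n' * x - ghbeta n' * gherm x m
             end
  end.

(** The squared norm as a product of recurrence coefficients. These are the generalized Hermite
    polynomials for $|x|^{2\mu} e^{-x^2/2}$ with $\mu = 1$, whence the shift by 2 at odd indices in
    [ghbeta]. *)
Fixpoint gherm_norm n : R :=
  match n with
  | 0 => 1
  | n'.+1 => ghbeta n'.+1 * gherm_norm n'
  end.

Lemma qhermS n : qherm n.+2 = qherm n.+1 * 'X + ghbeta n.+1 *: qherm n.
Proof. by []. Qed.

Lemma ghermS x n : gherm x n.+2 = gherm x n.+1 * x - ghbeta n.+1 * gherm x n.
Proof. by []. Qed.

Lemma ghbeta_gt0 n : 0 < ghbeta n.+1.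
Proof. by rewrite /ghbeta ltr0n; case: ifP. Qed.

Lemma gherm_norm_gt0 n : 0 < gherm_norm n.
Proof. by elim: n => //= n IH; rewrite mulr_gt0// ghbeta_gt0. Qed.

Lemma qherm_size_monic n : size (qherm n) = n.+1 /\ qherm n \is monic.
Proof.
have [m] := ubnP n; elim: m n => // m IH [|[|n]] nm.
- by rewrite size_poly1 monic1.
- by rewrite size_polyX monicX.
have [s1 m1] := IH n.+1 nm.
have [s0 _] := IH n (ltnW nm).
have sX : size (qherm n.+1 * 'X) = n.+3.
  by rewrite size_mulX ?s1// monic_neq0.
have lt : (size (ghbeta n.+1 *: qherm n)%R < size (qherm n.+1 * 'X)%R)%N.
  by rewrite sX (leq_ltn_trans (size_scale_leq _ _))// s0.
rewrite qhermS size_polyDl// sX; split => //.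
by rewrite monicE lead_coefDl// lead_coefMX -monicE.
Qed.

(** Since $u^{n+2} = -u^n$, the plus sign in the recurrence of [qherm] becomes the minus sign in
    that of [gherm]. *)
Lemma qherm_eval n (r : R) (u : quat R) : u * u = - 1 ->
  peval (map_poly qreal (qherm n)) (r *: u) = qreal (gherm r n) * u ^+ n.
Proof.
move=> u2; rewrite peval_real; have [m] := ubnP n; elim: m n => // m IH [|[|n]] nm.
- by rewrite rmorph1 hornerC expr0 rmorph1 mul1r.
- by rewrite map_polyX hornerX scale_qreal expr1.
have mapS (p q : {poly R}) b : map_poly qreal (p * 'X + b *: q) =
    map_poly qreal p * 'X + qreal b *: map_poly qreal q.
  apply/polyP => i; rewrite !(coef_map, coefD, coefZ, coefMX) /= rmorphD rmorphM.
  by case: i => [|i] //=; rewrite rmorph0.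
rewrite qhermS ghermS mapS hornerD hornerMX hornerZ.
rewrite (IH n.+1)// (IH n (ltnW nm)) scale_qreal.
have -> : qreal (gherm r n.+1 * r - ghbeta n.+1 * gherm r n) =
  qreal (gherm r n.+1) * qreal r - qreal (ghbeta n.+1) * qreal (gherm r n).
  by rewrite (rmorphB qreal) !(rmorphM qreal).
rewrite mulrBl; congr (_ + _).
  by rewrite [u ^+ n.+2]exprSr !mulrA; congr (_ * _); rewrite -!mulrA -(qreal_comm r).
have -> : u ^+ n.+2 = - u ^+ n by rewrite !exprS mulrA u2 mulN1r.
by rewrite mulrN opprK mulrA.
Qed.

(* [hankel n i] is the moment functional applied to [z^i * qherm n]. *)
Definition hankel n i : R := \sum_(k < n.+1) (qherm n)`_k * qmoment (k + i).

Lemma qmomentSS n : qmoment n.+2 = - (n + 3)%:R * qmoment n :> R.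
Proof. by []. Qed.

Lemma hankel0 i : hankel 0 i = qmoment i.
Proof. by rewrite /hankel big_ord1 polyseq1 mul1r add0n. Qed.

Lemma hankel1 i : hankel 1 i = qmoment i.+1.
Proof.
by rewrite /hankel big_ord_recr big_ord1 /= !coefX mul0r add0r mul1r.
Qed.

Lemma hankelS n i : hankel n.+2 i = hankel n.+1 i.+1 + ghbeta n.+1 * hankel n i.
Proof.
rewrite {1}/hankel.
under eq_bigr do rewrite qhermS coefD coefZ mulrDl.
rewrite big_split/=; congr (_ + _).
  rewrite big_ord_recl coefMX mul0r add0r; apply: eq_bigr => k _.
  by rewrite coefMX/= -addSnnS.
rewrite 2!big_ord_recr/= /hankel.
have [s _] := qherm_size_monic n.
rewrite (nth_default _ (n := n.+1)) ?s// (nth_default _ (n := n.+2)) ?s// mulr0 !mul0r !addr0 big_distrr/=.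
by apply: eq_bigr => k _; rewrite mulrA.
Qed.

(** Both parities go together since the recurrence couples them. The product contains a zero factor
    when [b < a]: this is orthogonality, and the column [b = 0] will be enough to start an induction
    on columns. *)
Lemma hankel_closed a b :
  hankel a.*2 b.*2 = (-1) ^+ a * qmoment b.*2 * \prod_(j < a) (2 * (b%:R - j%:R)) /\
  hankel a.*2.+1 b.*2.+1 = (-1) ^+ a * qmoment b.*2.+2 * \prod_(j < a) (2 * (b%:R - j%:R)).
Proof.
elim: a b => [|a IH] b.
  by rewrite hankel0 hankel1 big_ord0 !expr0 !mulr1 !mul1r.
(* Needed for every column [c]: the odd case below uses it at [b.+1]. *)
have h2 c : hankel a.+1.*2 c.*2 = (-1) ^+ a.+1 * qmoment c.*2 * \prod_(j < a.+1) (2 * (c%:R - j%:R)).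
  rewrite doubleS hankelS; have [-> ->] := IH c.
  rewrite /ghbeta /= odd_double /= big_ord_recr /= exprS qmomentSS.
  by rewrite -!natr1 natrD -!muln2 !natrM; ring.
split => //.
rewrite doubleS hankelS -doubleS -[b.*2.+2]/(b.+1.*2) h2.
have [_ ->] := IH b.
rewrite /ghbeta /= odd_double /=.
have -> : \prod_(j < a.+1) (2 * (b.+1%:R - j%:R)) = 2 * b.+1%:R * \prod_(j < a) (2 * (b%:R - j%:R)) :> R.
  rewrite big_ord_recl subr0; congr (_ * _); apply: eq_bigr => j _.
  by rewrite /bump /= -!natr1; ring.
rewrite big_ord_recr /= exprS (doubleS b).
have -> : a.+1.*2%:R = 2 * (a%:R + 1) :> R by rewrite -muln2 natrM natr1 mulrC.
by rewrite -!natr1; ring.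
Qed.

Lemma hankel_odd n i : odd (n + i) -> hankel n i = 0.
Proof.
have [m] := ubnP n; elim: m n i => // m IH [|[|n]] i nm o.
- by rewrite hankel0 qmoment_odd.
- by rewrite hankel1 qmoment_odd.
rewrite hankelS (IH n.+1)//; last by rewrite -addSnnS.
have -> : hankel n i = 0.
  by apply: IH; [exact: ltnW nm|rewrite !addSn /= negbK in o].
by rewrite mulr0 addr0.
Qed.

Lemma hankel_n0 n : hankel n.+1 0 = 0.
Proof.
have [od|ev] := boolP (odd n.+1); first by rewrite hankel_odd ?addn0.
rewrite -(odd_double_half n.+1) (negbTE ev) add0n -[0%N in LHS]double0.
have [-> _] := hankel_closed n.+1./2 0.
have : (0 < n.+1./2)%N by rewrite half_gt0; case: n ev.
case: _./2 => // k _.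
by rewrite big_ord_recl subrr !(mulr0, mul0r).
Qed.

(** Solved for its entry in column [i.+1], the recurrence carries vanishing over from column [i]. *)
Lemma hankel_lt n i : (i < n)%N -> hankel n i = 0.
Proof.
elim: i n => [|i IH] [|[|n]]// ni; first exact: hankel_n0.
  exact: hankel_n0.
have := hankelS n.+1 i; rewrite IH; last by rewrite ltnW// ltnW.
by rewrite (IH n.+1)// mulr0 addr0.
Qed.

(** As [hankel n.+2 n] vanishes, the recurrence makes each diagonal entry [- ghbeta] times the
    preceding one. *)
Lemma hankel_diag n : hankel n n = (-1) ^+ n * gherm_norm n.
Proof.
elim: n => [|[|n] IH]; first by rewrite hankel0 expr0 mulr1.
  by rewrite hankel1 qmomentSS (_ : qmoment 0 = 1)// /= /ghbeta /= add0n expr1 !mulr1 mulN1r.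
have := hankelS n.+1 n.+1; rewrite hankel_lt ?ltnSn// IH => /esym/eqP.
rewrite addr_eq0 => /eqP ->.
have -> : gherm_norm n.+2 = ghbeta n.+2 * gherm_norm n.+1 by [].
by rewrite [(-1) ^+ n.+2]exprS mulN1r mulNr mulrCA.
Qed.

(** [qherm n] has the parity of [n]; this absorbs the signs produced by conjugation. *)
Lemma coef_qherm_sign n k : (qherm n)`_k * (-1) ^+ k = (-1) ^+ n * (qherm n)`_k.
Proof.
have [m] := ubnP n; elim: m n k => // m IH [|[|n]] k nm.
- by rewrite coef1; case: k => [|k] /=; rewrite ?mul0r ?mulr0// mul1r mulr1.
- by rewrite coefX; case: k => [|[|k]] /=; rewrite ?mul0r ?mulr0// mul1r mulr1.
rewrite qhermS coefD coefZ coefMX mulrDl mulrDr -mulrA (IH n k (ltnW nm)).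
congr (_ + _); last by rewrite !exprS; ring.
case: k => [|k]; first by rewrite mul0r mulr0.
rewrite [k.+1 == 0%N]/= -[k.+1.-1]/k [(-1) ^+ k.+1]exprS mulrCA (IH n.+1 k nm).
by rewrite [(-1) ^+ n.+2]exprS mulrA.
Qed.

Lemma sum_qherm_sign n i :
  \sum_(k < n.+1) (qherm n)`_k * ((-1) ^+ k * qmoment (k + i)) = (-1) ^+ n * hankel n i.
Proof.
rewrite /hankel big_distrr/=; apply: eq_bigr => k _.
by rewrite !mulrA coef_qherm_sign.
Qed.

(** * Orthogonality, uniqueness, and the kernel on the diagonal *)

Definition qpoly n : {poly quat R} := map_poly qreal (qherm n).

Lemma size_qpoly n : size (qpoly n) = n.+1.
Proof. by rewrite size_map_poly; have [] := qherm_size_monic n. Qed.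

Lemma qpoly_monic n : qpoly n \is monic.
Proof. by rewrite map_monic; have [] := qherm_size_monic n. Qed.

Lemma coef_qpoly n k : (qpoly n)`_k = qreal (qherm n)`_k.
Proof. by rewrite coef_map. Qed.

Lemma qdot_qpolyE n q N : (size q <= N)%N ->
  qdot (peval (qpoly n)) (peval q) = \sum_(l < N) qreal ((-1) ^+ n * hankel n l) * q`_l.
Proof.
move=> qN; rewrite qdot_peval exchange_big/= size_qpoly.
have e l : \sum_(k < n.+1) qconj (qpoly n)`_k * qreal ((-1) ^+ k * qmoment (k + l)) * q`_l =
    qreal ((-1) ^+ n * hankel n l) * q`_l.
  rewrite -big_distrl/=; congr (_ * _); rewrite -sum_qherm_sign rmorph_sum/=.
  by apply: eq_bigr => k _; rewrite coef_qpoly qconj_qreal -rmorphM.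
under eq_bigr do rewrite e.
apply: (sum_poly_widen (F := fun c l => qreal ((-1) ^+ n * hankel n l) * c)) => //.
by move=> i; rewrite mulr0.
Qed.

Lemma qdot_qpolyl n q : (size q <= n.+1)%N ->
  qdot (peval (qpoly n)) (peval q) = qreal (gherm_norm n) * q`_n.
Proof.
move=> /qdot_qpolyE ->.
rewrite big_ord_recr/= hankel_diag mulrA -exprD addnn -mul2n exprM sqrrN !expr1n mul1r.
by rewrite big1 ?add0r// => l _; rewrite hankel_lt// mulr0 rmorph0 mul0r.
Qed.

Lemma qdot_qpolyr n p : (size p <= n)%N -> qdot (peval p) (peval (qpoly n)) = 0.
Proof.
move=> pn; rewrite qdot_peval size_qpoly big1// => k _.
have -> : \sum_(l < n.+1) qconj p`_k * qreal ((-1) ^+ k * qmoment (k + l)) * (qpoly n)`_l =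
    qconj p`_k * qreal ((-1) ^+ k * hankel n k).
  rewrite /hankel big_distrr/= rmorph_sum/= big_distrr/=; apply: eq_bigr => l _.
  by rewrite coef_qpoly -mulrA -rmorphM -mulrA addnC [_ * qmoment _]mulrC.
by rewrite hankel_lt ?mulr0 ?rmorph0 ?mulr0// (leq_trans _ pn).
Qed.

(** If the difference [d] of [P n] and [qpoly n] had degree [j < n], pairing it with [qpoly j],
    which is [P j] by induction, would give 0 by both orthogonalities, but also a positive norm
    times the leading coefficient of [d]. *)
Lemma monic_orthogonal_unique P : monic_orthogonal P -> forall n, P n = qpoly n.
Proof.
move=> [Pm Po] n; have [m] := ubnP n; elim: m n => // m IH n nm.
have [Mn sn] := Pm n.
apply/eqP; rewrite -subr_eq0; apply/eqP; set d := P n - qpoly n.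
have sd : (size d <= n)%N.
  apply/leq_sizeP => j; rewrite leq_eqVlt => /predU1P[<-|nj].
    rewrite coefB; move/monicP: Mn; rewrite lead_coefE sn => ->.
    by have /monicP := qpoly_monic n; rewrite lead_coefE size_qpoly => ->; rewrite subrr.
  by rewrite coefB !nth_default ?subrr// ?sn ?size_qpoly.
apply/eqP/negPn/negP => d0.
pose j := (size d).-1.
have sj : size d = j.+1 by rewrite /j prednK// lt0n size_poly_eq0.
have jn : (j < n)%N by rewrite -sj.
have : qdot (peval (qpoly j)) (peval d) = 0.
  rewrite (@qdot_qpolyE _ _ n.+1); last exact: leqW.
  under eq_bigr do rewrite coefB mulrBr.
  rewrite big_split/= sumrN -!qdot_qpolyE ?sn ?size_qpoly//.
  rewrite qdot_qpolyr ?size_qpoly// subr0 -(IH j); last by rewrite (leq_trans jn).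
  by apply: Po; rewrite ltn_eqF.
rewrite qdot_qpolyl ?sj// => /eqP; apply/negP.
have -> : d`_j = lead_coef d by rewrite lead_coefE.
have g0 : qreal (gherm_norm j) \is a GRing.unit.
  by rewrite rmorph_unit// unitfE gt_eqF ?gherm_norm_gt0.
by rewrite mulrI_eq0 ?lead_coef_eq0//; exact: mulrI.
Qed.

(** The factors [u ^+ k] on the two sides are unit quaternions and cancel, so that all directions
    give the same real number. *)
Lemma kernel_diag P n (r : R) (u : quat R) : monic_orthogonal P -> qre u = 0 -> qnorm u = 1 ->
  Defs.kernel P n (r *: u) (r *: u) = qreal (\sum_(k < n.+1) gherm r k ^+ 2 / gherm_norm k).
Proof.
move=> hP u0 u1.
have u2 : u * u = - 1 by rewrite pure_sqr// u1 expr1n rmorphN1.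
have uu k : u ^+ k * qconj (u ^+ k) = 1.
  elim: k => [|k IH]; first by rewrite expr0 mul1r; apply: quat_eqP; rewrite /= ?oppr0.
  by rewrite exprSr qconjM mulrA -(mulrA _ u) mul_qconj_self u1 expr1n rmorph1 mulr1.
rewrite /Defs.kernel rmorph_sum/=; apply: eq_bigr => k _.
rewrite (monic_orthogonal_unique hP) /hnorm (monic_orthogonal_unique hP).
rewrite qdot_qpolyl ?size_qpoly//.
have -> : (qpoly k)`_k = 1.
  by have /monicP := qpoly_monic k; rewrite lead_coefE size_qpoly.
rewrite mulr1 [in RHS]rmorphM/= fmorphV rmorphXn; congr (_ / _).
rewrite /qpoly qherm_eval// qconjM qconj_qreal expr2 mulrA -(mulrA _ (u ^+ k)) uu.
by rewrite mulr1.
Qed.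

Lemma rho_gherm P n (r : R) (u : quat R) : monic_orthogonal P -> qre u = 0 -> qnorm u = 1 ->
  rho P n (r *: u) = (\sum_(k < n.+1) gherm r k ^+ 2 / gherm_norm k) *
    ((2 * pi) `^ (- (3 / 2)) * expR (- (r ^+ 2 / 2))).
Proof.
move=> hP u0 u1; rewrite /rho /point_field_density /correlation_leb /correlation_mu.
rewrite (@moore_det_1x1 _ _ (\sum_(k < n.+1) gherm r k ^+ 2 / gherm_norm k)); last first.
  by rewrite mxE kernel_diag.
rewrite big_ord1 /gauss.
have -> : qnorm (r *: u) ^+ 2 = r ^+ 2; last by [].
by rewrite -[RHS]mulr1 -(expr1n _ 2) -u1 !qnorm2 /=; ring.
Qed.

End OrthogonalPolynomials.

(** * Adiabatic invariant of [y'' = - Q y] *)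

(** The arithmetic-geometric mean inequality, with [m ^+ 2] relaxed to [q]. *)
Lemma ler_norm_mul_quad (R : realType) (q v w m : R) : 0 <= m -> m ^+ 2 <= q ->
  `|v * w| * (2 * m) <= w ^+ 2 + q * v ^+ 2.
Proof.
move=> m0 mq; rewrite -[X in _ * X]ger0_norm ?mulr_ge0// -normrM ler_norml.
have h : 0 <= v ^+ 2 * (q - m ^+ 2) by rewrite mulr_ge0 ?sqr_ge0// subr_ge0.
have h1 := sqr_ge0 (w + m * v).
have h2 := sqr_ge0 (w - m * v).
apply/andP; split; lra.
Qed.

Section WKB.
Context {R : realType}.
Variables (y d : R -> R) (a c X : R).
Hypotheses (a0 : 0 < a) (c0 : 0 < c) (c1 : c <= 1) (X0 : 0 <= X).
Let Q x := a ^+ 2 - x ^+ 2 / 4.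
Hypotheses (yd : forall x, has_deriv y x (d x))
  (dd : forall x, has_deriv d x (- Q x * y x)).
(** [c] measures how far [X] stays from the turning point [2 * a], where [Q] vanishes. *)
Hypothesis QX : c ^+ 2 * a ^+ 2 <= Q X.
Let F x := d x ^+ 2 + Q x * y x ^+ 2.
Let G x := y x * d x.
(** Serves twice: for the relative size of the correction in [Z], and for the exponent in the growth
    of [Z] over [[0, X]]. *)
Let e : R := 8 / (c ^+ 5 * a ^+ 2).
Hypothesis e2 : e <= 2^-1.

(* The corrected adiabatic invariant: the derivative of [F^2 / Q] has a
   non-small part, which is cancelled by the derivative of the second term. *)
Let Z x := F x ^+ 2 * (Q x)^-1 - x / 2 * F x * G x * (Q x ^+ 2)^-1.
Let dZ x := - (F x * G x) / (2 * Q x ^+ 2) + x ^+ 2 * y x ^+ 2 * G x / (4 * Q x ^+ 2)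
   - x ^+ 2 * F x * G x / (2 * Q x ^+ 3).

Let Q_lb x : 0 <= x <= X -> c ^+ 2 * a ^+ 2 <= Q x.
Proof.
move=> /andP[x0 xX]; apply: (le_trans QX); rewrite /Q.
have : x ^+ 2 <= X ^+ 2 by rewrite ler_sqr ?nnegrE.
lra.
Qed.

Let m0 : 0 < c ^+ 2 * a ^+ 2. Proof. by rewrite mulr_gt0 ?exprn_gt0. Qed.

Let Q_gt0 x : 0 <= x <= X -> 0 < Q x.
Proof. by move=> /Q_lb; exact: lt_le_trans. Qed.

Let x_le x : 0 <= x <= X -> x <= 2 * a.
Proof.
move=> xX; have := Q_gt0 xX; rewrite /Q => h; case/andP: xX => x0 _.
by rewrite -ler_sqr ?nnegrE ?mulr_ge0 ?(ltW a0)// exprMn; lra.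
Qed.

(** Here $F' = -x y^2/2$ and $G' = y'^2 - Q y^2$, so $(F^2/Q)' = \frac{xF}{2Q^2} G'$. The product
    rule on the second term of [Z] removes exactly this and leaves [G] times the derivative of the
    slow coefficient. *)
Let Z_deriv x : 0 <= x <= X -> has_deriv Z x (dZ x).
Proof.
move=> xX; have Q0 := Q_gt0 xX.
have Qd t : has_deriv Q t (- t / 2).
  by rewrite /Q; derive_all; rewrite /=; field.
have Fd : has_deriv F x (- x / 2 * y x ^+ 2).
  apply: has_deriv_eq; first exact: has_derivD (has_derivX 2 (dd x)) (has_derivM (Qd x) (has_derivX 2 (yd x))).
  by rewrite /=; ring.
have Gd : has_deriv G x (d x ^+ 2 - Q x * y x ^+ 2).
  by apply: has_deriv_eq; [exact: has_derivM (yd x) (dd x)|ring].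
have Q1 : Q x != 0 by rewrite gt_eqF.
have Q2 : Q x ^+ 2 != 0 by rewrite expf_neq0.
apply: has_deriv_eq.
  apply: has_derivD.
    exact: has_derivM (has_derivX 2 Fd) (has_derivV Q1 (Qd x)).
  apply: has_derivN; apply: has_derivM.
    apply: has_derivM Gd; apply: has_derivM Fd.
    exact: has_derivM (has_deriv_id x) (has_deriv_cst 2^-1 x).
  exact: (has_derivV (f := fun t => Q t ^+ 2) Q2 (has_derivX 2 (Qd x))).
by rewrite /= /dZ /F /G; field.
Qed.

Let F_ge0 x : 0 <= x <= X -> 0 <= F x.
Proof. by move=> /Q_gt0/ltW ?; rewrite addr_ge0 ?sqr_ge0// mulr_ge0 ?sqr_ge0. Qed.

Let ca0 : 0 < c * a. Proof. exact: mulr_gt0. Qed.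

Let G_bound x : 0 <= x <= X -> `|G x| <= F x / (2 * (c * a)).
Proof.
move=> xX; rewrite ler_pdivlMr ?mulr_gt0// ler_norm_mul_quad ?(ltW ca0)//.
by rewrite exprMn Q_lb.
Qed.

Let y2_bound x : 0 <= x <= X -> y x ^+ 2 <= F x * (Q x)^-1.
Proof.
move=> xX; rewrite ler_pdivlMr ?Q_gt0// /F mulrC.
by have := sqr_ge0 (d x); lra.
Qed.

Let Qinv_bound x : 0 <= x <= X -> (Q x)^-1 <= (c ^+ 2 * a ^+ 2)^-1.
Proof. by move=> xX; rewrite lef_pV2 ?posrE ?Q_lb ?Q_gt0. Qed.

Let H x := F x ^+ 2 * (Q x)^-1.

Let H_ge0 x : 0 <= x <= X -> 0 <= H x.
Proof. by move=> xX; rewrite mulr_ge0 ?sqr_ge0// invr_ge0 ltW// Q_gt0. Qed.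

(** The correction is small relative to [H]: the bounds [x / 2 <= a], [|G| <= F / (2 c a)] and
    [1 / Q <= 1 / (c^2 a^2)] multiply to [1 / (2 c^3 a^2)], which is below [e] because [c <= 1]. *)
Let ZH x : 0 <= x <= X -> `|Z x - H x| <= e * H x.
Proof.
move=> xX; have Q0 := Q_gt0 xX; have x0 : 0 <= x by case/andP: xX.
have F0 := F_ge0 xX; have H0 := H_ge0 xX.
have -> : Z x - H x = - (x / 2 * F x * G x * (Q x ^+ 2)^-1) by rewrite /Z /H; ring.
have xF : 0 <= x / 2 * F x by rewrite mulr_ge0// divr_ge0.
have Q2 : 0 <= (Q x ^+ 2)^-1 by rewrite invr_ge0 sqr_ge0.
rewrite normrN normrM (ger0_norm Q2) [X in X * _]normrM (ger0_norm xF).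
apply: (@le_trans _ _ (a * F x * (F x / (2 * (c * a))) * (Q x ^+ 2)^-1)).
  rewrite ler_wpM2r// ler_pM ?G_bound//.
  by rewrite ler_wpM2r//; have := x_le xX; lra.
have -> : a * F x * (F x / (2 * (c * a))) * (Q x ^+ 2)^-1 = (2 * c)^-1 * (Q x)^-1 * H x.
  by rewrite /H; field; rewrite ?gt_eqF.
rewrite ler_wpM2r//.
apply: (@le_trans _ _ ((2 * c)^-1 * (c ^+ 2 * a ^+ 2)^-1)).
  by rewrite ler_wpM2l ?Qinv_bound// invr_ge0 mulr_ge0// ltW.
rewrite /e -invfM ler_pdivlMr ?mulr_gt0 ?exprn_gt0// mulrC ler_pdivrMr ?mulr_gt0 ?exprn_gt0//.
have : c ^+ 5 * a ^+ 2 <= c ^+ 3 * a ^+ 2.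
  rewrite ler_wpM2r ?sqr_ge0// ler_wiXn2l ?(ltW c0)//.
have : 0 < c ^+ 3 * a ^+ 2 by rewrite mulr_gt0 ?exprn_gt0.
rewrite (_ : 2 * c * (c ^+ 2 * a ^+ 2) = 2 * (c ^+ 3 * a ^+ 2)); last by ring.
lra.
Qed.

Let k : R := 4 / (c ^+ 5 * a ^+ 3).

(** Every term of [dZ] contains [G], which gains a factor [1 / (c a)] over [F]; the cofactor is at
    most $4 F / (Q c^4 a^2)$. Together they give $2 H / (c^5 a^3)$, and [H <= 2 Z] doubles the
    constant. *)
Let dZ_bound x : 0 <= x <= X -> `|dZ x| <= k * Z x.
Proof.
move=> xX; have Q0 := Q_gt0 xX; have x0 : 0 <= x by case/andP: xX.
have F0 := F_ge0 xX; have H0 := H_ge0 xX.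
have HZ : H x <= 2 * Z x.
  have := ZH xX; rewrite ler_norml => /andP[h _].
  have : e * H x <= 2^-1 * H x by rewrite ler_wpM2r.
  lra.
apply: (@le_trans _ _ (2 / (c ^+ 5 * a ^+ 3) * H x)); last first.
  have D0 : 0 <= (c ^+ 5 * a ^+ 3)^-1.
    by rewrite invr_ge0 mulr_ge0 ?exprn_ge0 ?(ltW c0) ?(ltW a0).
  have := ler_wpM2l D0 HZ; rewrite /k; move: (Z x) (H x) (_^-1) => z h t; lra.
pose w := (Q x)^-1.
have w0 : 0 <= w by rewrite invr_ge0 ltW.
have wb : w <= (c ^+ 2 * a ^+ 2)^-1 by exact: Qinv_bound.
pose B := - F x * w ^+ 2 / 2 + x ^+ 2 * y x ^+ 2 * w ^+ 2 / 4 - x ^+ 2 * F x * w ^+ 3 / 2.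
have -> : dZ x = G x * B.
  by rewrite /dZ /B /w; field; rewrite gt_eqF.
pose t := (a ^+ 2)^-1.
have t0 : 0 < t by rewrite invr_gt0 exprn_gt0.
have x2w : x ^+ 2 * w ^+ 2 <= 4 * ((c ^+ 4)^-1 * t).
  have -> : 4 * ((c ^+ 4)^-1 * t) = (2 * a) ^+ 2 * (c ^+ 2 * a ^+ 2)^-1 ^+ 2.
    by rewrite /t; field; rewrite !gt_eqF.
  apply: ler_pM; rewrite ?sqr_ge0//.
    by rewrite !expr2; apply: ler_pM => //; exact: x_le.
  by rewrite !expr2; exact: ler_pM.
have wt : w <= (c ^+ 4)^-1 * t.
  apply: (le_trans wb); rewrite invfM ler_wpM2r ?(ltW t0)// lef_pV2 ?posrE ?exprn_gt0//.
  by rewrite ler_wiXn2l ?(ltW c0).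
have Bb : `|B| <= F x * w * (4 * ((c ^+ 4)^-1 * t)).
  have y2 := y2_bound xX; rewrite -/w in y2.
  have Fw : 0 <= F x * w by rewrite mulr_ge0.
  have p1 : 0 <= F x * w * w <= F x * w * ((c ^+ 4)^-1 * t).
    by rewrite mulr_ge0//= ler_wpM2l.
  have p2 : 0 <= x ^+ 2 * y x ^+ 2 * w ^+ 2 <= F x * w * (4 * ((c ^+ 4)^-1 * t)).
    apply/andP; split; first by rewrite mulr_ge0 ?sqr_ge0// mulr_ge0 ?sqr_ge0.
    rewrite mulrAC mulrC; apply: ler_pM; rewrite ?sqr_ge0//.
    by rewrite mulr_ge0 ?sqr_ge0.
  have p3 : 0 <= x ^+ 2 * F x * w ^+ 3 <= F x * w * (4 * ((c ^+ 4)^-1 * t)).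
    apply/andP; split; first by rewrite mulr_ge0 ?exprn_ge0// mulr_ge0 ?sqr_ge0.
    rewrite (_ : x ^+ 2 * F x * w ^+ 3 = F x * w * (x ^+ 2 * w ^+ 2)); last by ring.
    by rewrite ler_wpM2l.
  have p4 : - F x * w ^+ 2 / 2 = - (F x * w * w) / 2 by ring.
  rewrite /B p4 ler_norml; move: p1 p2 p3 => /andP[p1 p1'] /andP[p2 p2'] /andP[p3 p3'].
  apply/andP; split; lra.
rewrite normrM; apply: (le_trans (ler_pM _ _ (G_bound xX) Bb)) => //.
rewrite le_eqVlt; apply/orP; left; apply/eqP.
by rewrite /H /w /t; field; rewrite !gt_eqF.
Qed.

Let k_ge0 : 0 <= k.
Proof. by rewrite divr_ge0// mulr_ge0 ?exprn_ge0 ?(ltW a0) ?(ltW c0). Qed.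

Let kX : k * X <= e.
Proof.
have XX : 0 <= X <= X by rewrite X0 lexx.
apply: (le_trans (ler_wpM2l k_ge0 (x_le XX))); rewrite le_eqVlt; apply/orP; left; apply/eqP.
by rewrite /k /e; field; rewrite !gt_eqF.
Qed.

Let Z0_ge0 x : 0 <= x <= X -> 0 <= Z x.
Proof.
move=> xX; have := ZH xX; rewrite ler_norml => /andP[h _].
have H0 := H_ge0 xX.
have : e * H x <= 2^-1 * H x by rewrite ler_wpM2r.
lra.
Qed.

Let Z_exp (b : R) x : 0 <= x <= X ->
  has_deriv (fun t => Z t * expR (b * t)) x ((dZ x + b * Z x) * expR (b * x)).
Proof.
move=> xX; apply: has_deriv_eq.
  apply: has_derivM (Z_deriv xX) _; apply: has_deriv_expR.
  exact: has_derivM (has_deriv_cst b x) (has_deriv_id x).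
by rewrite /=; ring.
Qed.

(** Gronwall's argument: [Z t * expR (k * t)] is nondecreasing. *)
Let Z_lower : Z 0 <= Z X * expR e.
Proof.
have XX : 0 <= X <= X by rewrite X0 lexx.
have h : Z 0 * expR (k * 0) <= Z X * expR (k * X).
  apply: (has_deriv_nondecreasing (f := fun t => Z t * expR (k * t))) X0 => x xX.
    exact: Z_exp.
  rewrite mulr_ge0 ?expR_ge0//; have := dZ_bound xX; rewrite ler_norml => /andP[]; lra.
rewrite mulr0 expR0 mulr1 in h; apply: (le_trans h).
by rewrite ler_wpM2l ?Z0_ge0// ler_expR.
Qed.

Let Z_upper : Z X <= Z 0 * expR e.
Proof.
have XX : 0 <= X <= X by rewrite X0 lexx.
have O0 : 0 <= (0 : R) <= X by rewrite lexx.
have h : - Z 0 * expR (- k * 0) <= - Z X * expR (- k * X).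
  apply: (has_deriv_nondecreasing (f := fun t => - Z t * expR (- k * t))
    (df := fun x => - ((dZ x + (- k) * Z x) * expR (- k * x)))) X0 => x xX.
    have := has_derivN (Z_exp (- k) xX).
    by under eq_fun do rewrite -mulNr.
  rewrite oppr_ge0 mulr_le0_ge0 ?expR_ge0//; have := dZ_bound xX; rewrite ler_norml => /andP[_]; lra.
rewrite mulr0 expR0 mulr1 mulNr lerN2 mulNr expRN ler_pdivrMr ?expR_gt0// in h.
apply: (le_trans h).
by rewrite ler_wpM2l ?Z0_ge0// ler_expR.
Qed.

Lemma wkb_energy_bounds :
  (1 - e) * (F X ^+ 2 / Q X) <= (1 + e) * (F 0 ^+ 2 / a ^+ 2) * expR e /\
  (1 - e) * (F 0 ^+ 2 / a ^+ 2) <= (1 + e) * (F X ^+ 2 / Q X) * expR e.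
Proof.
have XX : 0 <= X <= X by rewrite X0 lexx.
have O0 : 0 <= (0 : R) <= X by rewrite lexx.
have QQ : Q 0 = a ^+ 2 by rewrite /Q expr0n/= mul0r subr0.
have := ZH XX; rewrite ler_norml /H => /andP[h1 h2].
have := ZH O0; rewrite ler_norml /H QQ => /andP[h3 h4].
split.
  apply: (@le_trans _ _ (Z X)); first lra.
  apply: (le_trans Z_upper); rewrite ler_wpM2r ?expR_ge0//; lra.
apply: (@le_trans _ _ (Z 0)); first lra.
apply: (le_trans Z_lower); rewrite ler_wpM2r ?expR_ge0//; lra.
Qed.

End WKB.

(** * Hermite functions *)

Section Hermite.
Context {R : realType}.
Implicit Types (x : R) (n k : nat).

Fixpoint herm x n : R :=
  match n with
  | 0 => 1
  | n'.+1 => match n' with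
             | 0 => x
             | m.+1 => x * herm x n' - n'%:R * herm x m
             end
  end.

Lemma hermS x n : herm x n.+2 = x * herm x n.+1 - n.+1%:R * herm x n.
Proof. by []. Qed.

Lemma has_deriv_herm n x : has_deriv (herm^~ n) x (n%:R * herm x n.-1).
Proof.
have [m] := ubnP n; elim: m n => // m IH [|[|n]] nm.
- by apply: has_deriv_eq; [exact: (has_deriv_cst 1)|rewrite mul0r].
- by apply: has_deriv_eq; [exact: has_deriv_id|rewrite mulr1].
have h1 := IH n.+1 nm; have h0 := IH n (ltnW nm).
apply: has_deriv_eq.
  exact: (has_derivD (has_derivM (has_deriv_id x) h1)
    (has_derivN (has_derivM (has_deriv_cst n.+1%:R x) h0))).
rewrite -[n.+1.-1]/n -[n.+2.-1]/n.+1.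
case: n {nm h1 h0} => [|n]; first by rewrite /=; ring.
by rewrite -[n.+1.-1]/n hermS -!natr1; ring.
Qed.

Definition hermfun n x : R := herm x n * expR (- x ^+ 2 / 4).

Definition hermfun' n x : R := (n%:R * herm x n.-1 - x / 2 * herm x n) * expR (- x ^+ 2 / 4).

Lemma has_deriv_hermfun n x : has_deriv (hermfun n) x (hermfun' n x).
Proof.
apply: has_deriv_eq.
  apply: has_derivM (has_deriv_herm n x) _.
  by repeat derive_step.
by rewrite /= /hermfun'; field.
Qed.

(** The three-term recurrence in a form valid for all [n]: at 0 and 1 the truncated predecessors are
    multiplied by zero. *)
Lemma herm_pred n x : n%:R * (n.-1%:R * herm x n.-2) = n%:R * (x * herm x n.-1 - herm x n).
Proof. by case: n => [|[|n]]; rewrite ?mul0r//= ?mulr1 ?subrr ?mul0r ?mulr0//; ring. Qed.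

Lemma has_deriv_hermfun' n x :
  has_deriv (hermfun' n) x (- (n%:R + 2^-1 - x ^+ 2 / 4) * hermfun n x).
Proof.
apply: has_deriv_eq.
  apply: has_derivM.
    apply: has_derivD.
      exact: has_derivM (has_deriv_cst n%:R x) (has_deriv_herm n.-1 x).
    apply: has_derivN; apply: has_derivM (has_deriv_herm n x).
    by repeat derive_step.
  by repeat derive_step.
by rewrite /= /hermfun herm_pred; field.
Qed.

Definition herm_sum n x : R := \sum_(k < n.+1) herm x k ^+ 2 / k`!%:R * expR (- x ^+ 2 / 2).

Lemma herm_sum_energy n x : n`!%:R * herm_sum n x =
  hermfun' n x ^+ 2 + (n%:R + 1 - x ^+ 2 / 4) * hermfun n x ^+ 2.
Proof.
have e2 : expR (- x ^+ 2 / 2) = expR (- x ^+ 2 / 4) ^+ 2.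
  by rewrite [RHS]expr2 -expRD; congr expR; field.
rewrite /herm_sum -big_distrl/= e2 /hermfun /hermfun'.
(* The $x^2/4$ from the square of [hermfun'] cancels the one in the potential; the polynomial
   identity left is proved by induction on [n]. *)
suff e : n`!%:R * (\sum_(k < n.+1) herm x k ^+ 2 / k`!%:R) =
    (n%:R * herm x n.-1) ^+ 2 - x * n%:R * herm x n.-1 * herm x n + (n%:R + 1) * herm x n ^+ 2.
  by rewrite mulrA e; field.
elim: n => [|n IH].
  by rewrite big_ord1 /= fact0; field.
rewrite big_ord_recr [in LHS]/= mulrDr factS natrM -mulrA IH.
have nf : n`!%:R != 0 :> R by rewrite pnatr_eq0 -lt0n fact_gt0.
have n1 : n.+1%:R != 0 :> R by [].
have -> : n.+1%:R * n`!%:R * (herm x n.+1 ^+ 2 / (n.+1%:R * n`!%:R)) = herm x n.+1 ^+ 2.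
  by rewrite mulrCA divff ?mulr1// mulf_neq0.
rewrite -[n.+1.-1]/n; case: n {IH nf n1} => [|n]; first by rewrite /=; ring.
rewrite -[n.+1.-1]/n hermS -!natr1; ring.
Qed.

Lemma herm_sum_ge0 n x : 0 <= herm_sum n x.
Proof.
by apply: sumr_ge0 => k _; rewrite mulr_ge0 ?expR_ge0// divr_ge0 ?sqr_ge0.
Qed.

Lemma herm_sum_mono m n x : (m <= n)%N -> herm_sum m x <= herm_sum n x.
Proof.
move=> /subnKC <-; elim: (n - m)%N => [|k IH]; first by rewrite addn0.
apply: (le_trans IH); rewrite addnS /herm_sum [leRHS]big_ord_recr/= lerDl.
by rewrite mulr_ge0 ?expR_ge0// divr_ge0 ?sqr_ge0.
Qed.

Local Arguments herm : simpl never.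

(** At 0 the odd terms vanish and the even ones are the ratios $w_j$, for which $(2m+2) w_{m+1} =
    (2m+1) w_m$; hence $w_0 + \dots + w_m = (2m+1) w_m$. *)
Lemma herm_sum0_double m :
  herm_sum m.*2 0 = (2 * m + 1)%:R * central_binomial_ratio m /\
  herm_sum m.*2.+1 0 = (2 * m + 1)%:R * central_binomial_ratio m.
Proof.
have odd0 j : herm 0 j.*2.+1 = 0 :> R.
  by elim: j => // j IH; rewrite doubleS hermS mul0r IH mulr0 subr0.
have even0 j : herm 0 j.*2 ^+ 2 / (j.*2)`!%:R = central_binomial_ratio j :> R.
  elim: j => [|j IH]; first by rewrite /central_binomial_ratio big_ord0 -[herm _ _]/1 fact0 divr1 expr1n.
  rewrite /central_binomial_ratio big_ord_recr -/(central_binomial_ratio j) -IH.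
  rewrite doubleS hermS mul0r sub0r !factS !natrM.
  have nf : j.*2`!%:R != 0 :> R by rewrite pnatr_eq0 -lt0n fact_gt0.
  have -> : (2 * j + 1)%:R = j.*2.+1%:R :> R by rewrite mul2n addn1.
  have -> : (2 * j + 2)%:R = j.*2.+2%:R :> R by rewrite mul2n addn2.
  rewrite [RHS]/=; have b0 : j.*2.+2%:R != 0 :> R by [].
  have a0 : j.*2.+1%:R != 0 :> R by [].
  move: (j.*2.+1)%:R (j.*2.+2)%:R a0 b0 (herm 0 j.*2) => a b a0 b0 h.
  by field; rewrite nf a0 b0.
have ex0 : expR (- 0 ^+ 2 / 2) = 1 :> R by rewrite expr0n/= oppr0 mul0r expR0.
have step k : herm_sum k.+1 0 = herm_sum k 0 + herm 0 k.+1 ^+ 2 / k.+1`!%:R.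
  by rewrite /herm_sum big_ord_recr ex0 mulr1.
have odd_step k : herm_sum k.*2.+1 0 = herm_sum k.*2 0.
  by rewrite step odd0 expr0n/= mul0r addr0.
rewrite odd_step; suff -> : herm_sum m.*2 0 = (2 * m + 1)%:R * central_binomial_ratio m by [].
elim: m => [|m IH].
  by rewrite /herm_sum big_ord1 ex0 muln0 add0n mul1r mulr1; exact: (even0 0%N).
rewrite doubleS step odd_step -doubleS even0 IH.
rewrite /central_binomial_ratio big_ord_recr -/(central_binomial_ratio m) /=.
have m2 : (2 * m + 2)%:R != 0 :> R by rewrite pnatr_eq0 addn2.
have -> : (2 * m.+1 + 1)%:R = (2 * m + 2)%:R + 1 :> R by rewrite natr1 mulnS; congr _%:R; lia.
by field.
Qed.

Lemma herm_sum0_bounds n : (1 < n)%N ->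
  2 / pi * n%:R <= herm_sum n 0 ^+ 2 <= 2 / pi * (n + 3)%:R.
Proof.
move=> n1; pose m := n./2.
have m0 : (0 < m)%N by rewrite half_gt0.
have Em : herm_sum n 0 = (2 * m + 1)%:R * central_binomial_ratio m.
  rewrite -(odd_double_half n) -/m; have [h0 h1] := herm_sum0_double m.
  by case: (odd n).
have nm : (2 * m <= n <= 2 * m + 1)%N.
  by rewrite -[n in X in _ && X]odd_double_half -[n in X in X && _]odd_double_half -/m -mul2n; case: odd; lia.
have := @wallis R _ m0; rewrite Em exprMn.
move: (@pi R) (pi_gt0 R) => p pi0.
have A0 : 0 < (2 * m)%:R :> R by rewrite ltr0n muln_gt0.
have A1 : 1 <= (2 * m)%:R :> R by rewrite ler1n muln_gt0.
have nl : n%:R <= (2 * m)%:R + 1 :> R by rewrite natr1 ler_nat; lia.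
have nu : (2 * m)%:R <= n%:R :> R by rewrite ler_nat; lia.
rewrite (natrD _ (2 * m) 1) (natrD _ n 3).
move: (2 * m)%:R (central_binomial_ratio m ^+ 2) A0 A1 nl nu => A w A0 A1 nl nu /andP[w1 w2].
have A10 : 0 < A + 1 by rewrite addr_gt0.
have p0 : 0 <= 2 / p :> R by rewrite divr_ge0// ltW.
have {}w1 : 2 / p / (A + 1) <= w by rewrite -mulrA -invfM.
have {}w2 : w <= 2 / p / A by rewrite -mulrA -invfM.
apply/andP; split.
  apply: (@le_trans _ _ ((A + 1) ^+ 2 * (2 / p / (A + 1)))).
    have -> : (A + 1) ^+ 2 * (2 / p / (A + 1)) = 2 / p * (A + 1).
      by field; rewrite !gt_eqF.
    by rewrite ler_wpM2l.
  by rewrite ler_wpM2l// sqr_ge0.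
apply: (@le_trans _ _ ((A + 1) ^+ 2 * (2 / p / A))).
  by rewrite ler_wpM2l// sqr_ge0.
(* The 3 in the upper bound: [A + 2 + A^-1 <= A + 3], and [A <= n]. *)
have -> : (A + 1) ^+ 2 * (2 / p / A) = 2 / p * (A + 2 + A^-1).
  by field; rewrite !gt_eqF.
rewrite ler_wpM2l//.
have : A^-1 <= 1 by rewrite invf_le1.
lra.
Qed.

End Hermite.

(** * Asymptotics of the Hermite sum *)

Section HermiteSumAsymptotics.
Context {R : realType}.
Implicit Types (x : R) (n k : nat).

(** One factor [1 + e] comes from the invariant, the other two from squaring the comparison of the
    sum with the energy [F]. *)
Lemma herm_sum_wkb n (c X : R) : let A := n%:R + 2^-1 in
  let q := 1 - X ^+ 2 / 4 / A in let e := 8 / c ^+ 5 / A in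
  0 < c -> c <= 1 -> 0 <= X -> c ^+ 2 <= q -> e <= 2^-1 ->
  (1 - e) * herm_sum n X ^+ 2 <= (1 + e) ^+ 3 * expR e * (q * herm_sum n 0 ^+ 2) /\
  (1 - e) * (q * herm_sum n 0 ^+ 2) <= (1 + e) ^+ 3 * expR e * herm_sum n X ^+ 2.
Proof.
move=> A q e c0 c1 X0 cq e2.
have A0 : 0 < A by rewrite ltr_wpDl.
pose a := Num.sqrt A.
have a0 : 0 < a by rewrite sqrtr_gt0.
have a2 : a ^+ 2 = A by rewrite sqr_sqrtr// ltW.
have eE : e = 8 / (c ^+ 5 * a ^+ 2) by rewrite a2 invfM mulrA.
have e0 : 0 < e by rewrite /e !divr_gt0// exprn_gt0.
have qA : a ^+ 2 - X ^+ 2 / 4 = q * A.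
  by rewrite a2 /q mulrBl mul1r mulfVK ?gt_eqF.
have QX : c ^+ 2 * a ^+ 2 <= a ^+ 2 - X ^+ 2 / 4 by rewrite qA a2 ler_wpM2r// ltW.
have dd x : has_deriv (hermfun' n) x (- (a ^+ 2 - x ^+ 2 / 4) * hermfun n x).
  by rewrite a2; exact: has_deriv_hermfun'.
pose F x := hermfun' n x ^+ 2 + (A - x ^+ 2 / 4) * hermfun n x ^+ 2.
have [] := @wkb_energy_bounds R _ _ a c X a0 c0 c1 X0 (has_deriv_hermfun n) dd QX.
  by rewrite -eE.
rewrite -eE !a2 -/(F X) expr0n/= mul0r subr0.
have -> : hermfun' n 0 ^+ 2 + A * hermfun n 0 ^+ 2 = F 0.
  by rewrite /F expr0n/= mul0r subr0.
have qA' : A - X ^+ 2 / 4 = q * A by rewrite -qA a2.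
rewrite qA'.
have q0 : 0 < q by rewrite (lt_le_trans _ cq)// exprn_gt0.
(* The sum has [n + 1] where [F] has [n + 1/2]. The excess $y^2/2$ is at most [e * F x], since $c^2
   A y^2 \le F$ and $e c^2 A = 8/c^3 \ge 8$. *)
have FE x : c ^+ 2 * A <= A - x ^+ 2 / 4 ->
    F x <= n`!%:R * herm_sum n x <= (1 + e) * F x.
  move=> cx; rewrite herm_sum_energy.
  have y0 := sqr_ge0 (hermfun n x).
  have cA : 0 < c ^+ 2 * A by rewrite mulr_gt0 ?exprn_gt0.
  have -> : hermfun' n x ^+ 2 + (n%:R + 1 - x ^+ 2 / 4) * hermfun n x ^+ 2 =
     F x + hermfun n x ^+ 2 / 2 by rewrite /F /A; field.
  rewrite lerDl divr_ge0//= mulrDl mul1r lerD2l.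
  have h1 : e * (c ^+ 2 * A) = 8 / c ^+ 3.
    by rewrite /e; field; rewrite !gt_eqF.
  have h2 : 8 <= 8 / c ^+ 3.
    by rewrite ler_peMr// invf_ge1 ?exprn_gt0// exprn_ile1// ltW.
  have h3 : c ^+ 2 * A * hermfun n x ^+ 2 <= F x.
    by rewrite -[leLHS]add0r lerD ?sqr_ge0// ler_wpM2r.
  apply: (le_trans _ (ler_wpM2l (ltW e0) h3)).
  rewrite mulrA h1; have := ler_wpM2r y0 h2; lra.
have nf : 0 < n`!%:R :> R by rewrite ltr0n fact_gt0.
have cA : c ^+ 2 * A <= A - X ^+ 2 / 4 by rewrite -a2.
have cA0 : c ^+ 2 * A <= A - 0 ^+ 2 / 4.
  by rewrite expr0n/= mul0r subr0 ger_pMl// exprn_ile1// ltW.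
have F_ge0 x : c ^+ 2 * A <= A - x ^+ 2 / 4 -> 0 <= F x.
  move=> cx; rewrite addr_ge0 ?sqr_ge0// mulr_ge0 ?sqr_ge0// (le_trans _ cx)//.
  by rewrite mulr_ge0 ?sqr_ge0// ltW.
have sq x : c ^+ 2 * A <= A - x ^+ 2 / 4 ->
    F x ^+ 2 <= n`!%:R ^+ 2 * herm_sum n x ^+ 2 <= (1 + e) ^+ 2 * F x ^+ 2.
  move=> cx; have /andP[h1 h2] := FE x cx; have Fx := F_ge0 x cx.
  have nE : 0 <= n`!%:R * herm_sum n x by rewrite mulr_ge0 ?herm_sum_ge0 ?(ltW nf).
  have eF : 0 <= (1 + e) * F x by apply: mulr_ge0 => //; exact: addr_ge0 (ltW e0).
  by rewrite -!exprMn !ler_sqr ?nnegrE ?h1.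
have /andP[s1 s2] := sq X cA; have /andP[s3 s4] := sq 0 cA0.
have nf2 : 0 < n`!%:R ^+ 2 :> R by rewrite exprn_gt0.
set S := herm_sum n X ^+ 2 in s1 s2 *; set S0 := herm_sum n 0 ^+ 2 in s3 s4 *.
have e1 : 0 <= 1 - e by lra.
have p1 : 0 <= (1 + e) * expR e by rewrite mulr_ge0 ?expR_ge0 ?addr_ge0 ?ltW.
have p2 : 0 <= (1 + e) ^+ 2 by rewrite sqr_ge0.
move=> w1 w2; split.
- rewrite -(ler_pM2l nf2).
  apply: (@le_trans _ _ ((1 - e) * ((1 + e) ^+ 2 * F X ^+ 2))).
    by rewrite mulrCA ler_wpM2l.
  have {}w1 : (1 - e) * F X ^+ 2 <= (1 + e) * expR e * (q * F 0 ^+ 2).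
    have := ler_wpM2r (mulr_ge0 (ltW q0) (ltW A0)) w1.
    rewrite (_ : _ * _ * (q * A) = (1 - e) * F X ^+ 2); last by field; rewrite !gt_eqF.
    by move/le_trans; apply; rewrite le_eqVlt; apply/orP; left; apply/eqP; field; rewrite !gt_eqF.
  rewrite mulrCA; apply: (le_trans (ler_wpM2l p2 w1)).
  have := ler_wpM2l (mulr_ge0 p2 (mulr_ge0 p1 (ltW q0))) s3.
  rewrite le_eqVlt => h; lra.
- rewrite -(ler_pM2l nf2).
  apply: (@le_trans _ _ ((1 - e) * q * ((1 + e) ^+ 2 * F 0 ^+ 2))).
    have := ler_wpM2l (mulr_ge0 e1 (ltW q0)) s4; lra.
  have {}w2 : (1 - e) * q * F 0 ^+ 2 <= (1 + e) * expR e * F X ^+ 2.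
    have := ler_wpM2r (mulr_ge0 (ltW q0) (ltW A0)) w2.
    rewrite (_ : _ * _ * (q * A) = (1 - e) * q * F 0 ^+ 2); last by field; rewrite !gt_eqF.
    by move/le_trans; apply; rewrite le_eqVlt; apply/orP; left; apply/eqP; field; rewrite !gt_eqF.
  have := ler_wpM2l p2 w2.
  have := ler_wpM2l (mulr_ge0 p2 p1) s1.
  lra.
Qed.

End HermiteSumAsymptotics.

Section HermiteSumLimit.
Context {R : realType}.
Implicit Types (n k : nat).

Lemma cvg_invn : (n%:R^-1 : R) @[n --> \oo] --> (0 : R).
Proof. by rewrite -cvg_shiftS; exact: cvg_harmonic. Qed.

(** The index [N n] is kept apart from the scale [n] so that both regimes are covered: [nu = 1]
    inside the bulk, [nu] slightly above [sg] outside. The condition [sg < nu] places the point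
    before the turning point of index [N n]. *)
Lemma cvg_herm_sum (N : nat -> nat) (x : nat -> R) (nu sg : R) :
  (forall n, 0 <= x n) -> 0 <= sg -> sg < nu ->
  (N n)%:R / n%:R @[n --> \oo] --> nu ->
  x n ^+ 2 / 4 / n%:R @[n --> \oo] --> sg ->
  herm_sum (N n) (x n) ^+ 2 / n%:R @[n --> \oo] --> 2 / pi * (nu - sg).
Proof.
move=> x0 sg0 sgnu Nnu xsg.
have nu0 : 0 < nu by rewrite (le_lt_trans sg0).
pose A n : R := (N n)%:R + 2^-1.
have A0 n : 0 < A n by rewrite ltr_wpDl.
have An : A n / n%:R @[n --> \oo] --> nu.
  rewrite -[nu]addr0 -[X in nu + X](mulr0 2^-1).
  under eq_fun do rewrite mulrDl.
  by apply: cvgD => //; apply: cvgMr; exact: cvg_invn.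
have iAn : (A n / n%:R)^-1 @[n --> \oo] --> nu^-1.
  by apply: cvgV => //; rewrite gt_eqF.
pose q n : R := 1 - x n ^+ 2 / 4 / A n.
pose dl := 1 - sg / nu.
have dl0 : 0 < dl by rewrite subr_gt0 ltr_pdivrMr// mul1r.
have dl1 : dl <= 1 by rewrite gerBl divr_ge0// ltW.
have qdl : q n @[n --> \oo] --> dl.
  have : 1 - (x n ^+ 2 / 4 / n%:R) * (A n / n%:R)^-1 @[n --> \oo] --> dl.
    by apply: cvgB; [exact: cvg_cst|exact: cvgM].
  apply: cvg_trans; apply: near_eq_cvg; near=> n.
  have n0 : (n%:R : R) != 0 by rewrite pnatr_eq0 -lt0n; near: n; exact: nbhs_infty_gt.
  rewrite /q; congr (1 - _); field; rewrite n0 gt_eqF ?A0//.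
(* As [dl <= 1], the square of [c] is strictly below [dl], the limit of [q n]; so [c ^+ 2 <= q n]
   eventually. *)
pose c := dl / 2.
have c0 : 0 < c by rewrite divr_gt0.
have c1 : c <= 1 by rewrite ler_pdivrMr// mul1r; lra.
have cdl : c ^+ 2 < dl.
  have : dl ^+ 2 <= dl by rewrite expr2 ger_pMl.
  by rewrite /c expr_div_n; lra.
pose e n : R := 8 / c ^+ 5 / A n.
have e_gt0 n : 0 < e n by rewrite /e !divr_gt0// exprn_gt0.
have e0 : e n @[n --> \oo] --> (0 : R).
  have : 8 / c ^+ 5 * (n%:R^-1 * (A n / n%:R)^-1) @[n --> \oo] --> 8 / c ^+ 5 * (0 * nu^-1).
    by apply: cvgMr; apply: cvgM => //; exact: cvg_invn.
  rewrite mul0r mulr0.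
  apply: cvg_trans; apply: near_eq_cvg; near=> n.
  have n0 : (n%:R : R) != 0 by rewrite pnatr_eq0 -lt0n; near: n; exact: nbhs_infty_gt.
  by rewrite /e; field; rewrite n0 ?gt_eqF ?A0.
pose U n := (1 + e n) ^+ 3 * expR (e n).
have e1 : 1 + e n @[n --> \oo] --> (1 : R).
  by rewrite -[X in _ --> X]addr0; apply: cvgD => //; exact: cvg_cst.
have e1' : 1 - e n @[n --> \oo] --> (1 : R).
  by rewrite -[X in _ --> X]subr0; apply: cvgB => //; exact: cvg_cst.
have U1 : U n @[n --> \oo] --> (1 : R).
  have hE : expR (e n) @[n --> \oo] --> expR 0.
    by apply: continuous_cvg => //; exact: continuous_expR.
  have : (1 + e n) * ((1 + e n) * (1 + e n)) * expR (e n) @[n --> \oo] --> 1 * (1 * 1) * expR (0 : R).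
    by apply: cvgM => //; apply: cvgM => //; exact: cvgM.
  rewrite expR0 !mulr1; apply: cvg_trans.
  by apply: near_eq_cvg; near=> n; rewrite /U /= !exprS expr0 mulr1.
have lo : (1 - e n) / U n * (q n * (2 / pi * ((N n)%:R / n%:R))) @[n --> \oo] --> 2 / pi * (nu - sg).
  have -> : 2 / pi * (nu - sg) = 1 / 1 * (dl * (2 / pi * nu)).
    rewrite /dl; move: (@pi R) (pi_gt0 R) => p p0; field; rewrite !gt_eqF//.
  apply: cvgM.
    by apply: cvgM => //; apply: cvgV.
  by apply: cvgM => //; apply: cvgMr.
have up : U n / (1 - e n) * (q n * (2 / pi * ((N n)%:R / n%:R + 3 / n%:R))) @[n --> \oo] --> 2 / pi * (nu - sg).
  have -> : 2 / pi * (nu - sg) = 1 / 1 * (dl * (2 / pi * (nu + 3 * 0))).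
    rewrite /dl; move: (@pi R) (pi_gt0 R) => p p0; field; rewrite !gt_eqF//.
  apply: cvgM.
    by apply: cvgM => //; apply: cvgV.
  apply: cvgM => //; apply: cvgMr; apply: cvgD => //.
  by apply: cvgMr; exact: cvg_invn.
apply: (squeeze_cvgr _ lo up).
near=> n.
have n0 : 0 < n%:R :> R by rewrite ltr0n; near: n; exact: nbhs_infty_gt.
have N1 : (1 < N n)%N.
  have h1 : nu / 2 < (N n)%:R / n%:R.
    by near: n; apply: (cvgr_gt _ Nnu); rewrite ltr_pdivrMr// mulr2n mulrDr mulr1 ltrDl.
  have h2 : n%:R^-1 < nu / 4.
    by near: n; apply: (cvgr_lt _ cvg_invn); rewrite divr_gt0.
  rewrite -(ltr_nat R) -(ltr_pM2r (x := n%:R^-1)) ?invr_gt0//; lra.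
have e2 : e n <= 2^-1.
  by apply/ltW; near: n; apply: (cvgr_lt _ e0); rewrite invr_gt0.
have cq : c ^+ 2 <= q n.
  by apply/ltW; near: n; exact: (cvgr_gt _ qdl).
have q0 : 0 < q n by rewrite (lt_le_trans _ cq)// exprn_gt0.
have [w1 w2] := herm_sum_wkb c0 c1 (x0 n) cq e2.
rewrite -/(e n) -/(A n) -/(q n) -/(U n) in w1 w2.
have /andP[b1 b2] := herm_sum0_bounds N1 (R := R).
have U0 : 0 < U n by rewrite mulr_gt0 ?expR_gt0// exprn_gt0// ltr_wpDr// ltW.
have me : 0 < 1 - e n by rewrite subr_gt0 (le_lt_trans e2)// invf_lt1// ltr1n.
apply/andP; split.
- have -> : (1 - e n) / U n * (q n * (2 / pi * ((N n)%:R / n%:R))) =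
     (1 - e n) * (q n * (2 / pi * (N n)%:R)) / U n / n%:R.
    by rewrite -!mulrA; ring.
  rewrite ler_wpM2r ?invr_ge0 ?(ltW n0)// ler_pdivrMr// [leRHS]mulrC.
  by apply: (le_trans _ w2); rewrite ler_wpM2l ?(ltW me)// ler_wpM2l// ltW.
- have -> : U n / (1 - e n) * (q n * (2 / pi * ((N n)%:R / n%:R + 3 / n%:R))) =
     U n * (q n * (2 / pi * (N n + 3)%:R)) / (1 - e n) / n%:R.
    by rewrite natrD; ring.
  rewrite ler_wpM2r ?invr_ge0 ?(ltW n0)// ler_pdivlMr// mulrC.
  by apply: (le_trans w1); rewrite ler_wpM2l ?(ltW U0)// ler_wpM2l// ltW.
Unshelve. all: by end_near. Qed.

End HermiteSumLimit.

(** * Comparison of the kernel with the Hermite sum *)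

Section KernelComparison.
Context {R : realType}.
Implicit Types (x : R) (n k : nat).
Local Arguments herm : simpl never.
Local Arguments gherm : simpl never.

(** [x * gherm x n] is Gaussian-orthogonal to all [x * q] with [q] of degree below [n], and vanishes
    at 0. For even [n] it is $He_{n+1}$. For odd [n] it is $He_{n+1} + He_n/x$, where the second
    term restores the zero at 0; the identity is multiplied by x to avoid the division. *)
Lemma gherm_herm x m : x * gherm x m.*2 = herm x m.*2.+1 /\
  x ^+ 2 * gherm x m.*2.+1 = x * herm x m.*2.+2 + herm x m.*2.+1.
Proof.
elim: m => [|m [IH0 IH1]].
  rewrite double0; have -> : herm x 2 = x * x - 1 by rewrite hermS mulr1.
  by rewrite -[gherm x 0]/1 -[gherm x 1]/x -[herm x 1]/x; split; ring.
have h0 : x * gherm x m.+1.*2 = herm x m.+1.*2.+1.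
  rewrite doubleS ghermS /ghbeta /= odd_double /=.
  have -> : x * (gherm x m.*2.+1 * x - m.*2.+3%:R * gherm x m.*2) =
     x ^+ 2 * gherm x m.*2.+1 - m.*2.+3%:R * (x * gherm x m.*2) by ring.
  by rewrite IH0 IH1 (hermS x m.*2.+1) -!natr1; ring.
split => //.
rewrite doubleS in h0 *; rewrite ghermS /ghbeta /= odd_double /=.
have -> : x ^+ 2 * (gherm x m.*2.+2 * x - m.*2.+2%:R * gherm x m.*2.+1) =
   x ^+ 2 * (x * gherm x m.*2.+2) - m.*2.+2%:R * (x ^+ 2 * gherm x m.*2.+1) by ring.
by rewrite h0 IH1 (hermS x m.*2.+2) (hermS x m.*2.+1) -!natr1; ring.
Qed.

Lemma gherm_normE m : gherm_norm m.*2 = (m.*2.+1)`!%:R :> R /\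
  gherm_norm m.*2.+1 = (m.*2.+3 * (m.*2.+1)`!)%:R :> R.
Proof.
have S k : gherm_norm k.+1 = ghbeta k.+1 * gherm_norm k :> R by [].
elim: m => [|m [IH0 IH1]].
  by rewrite S /ghbeta /= mulr1 muln1.
have h0 : gherm_norm m.+1.*2 = (m.+1.*2.+1)`!%:R :> R.
  rewrite doubleS S IH1 /ghbeta /= odd_double /= -natrM; congr _%:R.
  by rewrite (factS m.*2.+2) (factS m.*2.+1) mulnCA.
by split => //; rewrite S h0 /ghbeta /= odd_double /= natrM doubleS.
Qed.

(** Meant for [K = 2m + 2] and [h], [h'] the Hermite values of orders 2m + 1 and 2m + 2, so that
    [x * h' - K * h] is the value of order 2m + 3. *)
Lemma odd_term_bound (x K h h' : R) : 1 <= x -> 1 <= K ->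
  `|(x * h' + h) ^+ 2 / (x ^+ 2 * (K + 1)) - h' ^+ 2 / K| <=
  4 / x * (h ^+ 2 + h' ^+ 2 / K + (x * h' - K * h) ^+ 2 / (K * (K + 1))).
Proof.
move=> x1 K1.
have x0 : 0 < x by rewrite (lt_le_trans _ x1).
have K0 : 0 < K by rewrite (lt_le_trans _ K1).
have K10 : 0 < K + 1 by rewrite addr_gt0.
have D0 : 0 < K * (K + 1) * x by rewrite !mulr_gt0.
rewrite -(ler_pM2l D0) -[X in X * `|_|]gtr0_norm// -normrM.
have -> : K * (K + 1) * x * ((x * h' + h) ^+ 2 / (x ^+ 2 * (K + 1)) - h' ^+ 2 / K) =
   - (x * h' ^+ 2) + 2 * K * h * h' + K * h ^+ 2 / x.
  by field; rewrite !gt_eqF.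
have -> : K * (K + 1) * x * (4 / x * (h ^+ 2 + h' ^+ 2 / K + (x * h' - K * h) ^+ 2 / (K * (K + 1)))) =
   4 * (K * (K + 1) * h ^+ 2 + (K + 1) * h' ^+ 2 + (x * h' - K * h) ^+ 2).
  by field; rewrite !gt_eqF.
have hh := sqr_ge0 h; have hh' := sqr_ge0 h'.
(* For [x] large compared with [K] the term in [h' ^+ 2] on the right does not suffice; [x * h'] is
   split as [(x * h' - K * h) + K * h], which is why the next Hermite value enters the bound. *)
have b1 : 0 <= x * h' ^+ 2 <= 2 * (x * h' - K * h) ^+ 2 + 2 * K ^+ 2 * h ^+ 2.
  apply/andP; split; first by rewrite mulr_ge0// ltW.
  apply: (@le_trans _ _ (x ^+ 2 * h' ^+ 2)).
    by rewrite ler_wpM2r// expr2 ler_peMl// ltW.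
  by have := sqr_ge0 (x * h' - 2 * K * h); lra.
have b2 : - (K ^+ 2 * h ^+ 2 + h' ^+ 2) <= 2 * K * h * h' <= K ^+ 2 * h ^+ 2 + h' ^+ 2.
  have := sqr_ge0 (K * h - h'); have := sqr_ge0 (K * h + h') => ? ?.
  apply/andP; split; lra.
have b3 : 0 <= K * h ^+ 2 / x <= K * h ^+ 2.
  have Kh : 0 <= K * h ^+ 2 by rewrite mulr_ge0// ltW.
  rewrite divr_ge0 ?(ltW x0)//= ler_pdivrMr// ler_peMr//.
have b4 : 0 <= K * h ^+ 2 by rewrite mulr_ge0// ltW.
have b5 : 0 <= K * h' ^+ 2 by rewrite mulr_ge0// ltW.
have b6 : 0 <= K ^+ 2 * h ^+ 2 by rewrite mulr_ge0// sqr_ge0.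
have b7 := sqr_ge0 (x * h' - K * h).
move: b1 b2 b3 => /andP[? ?] /andP[? ?] /andP[? ?].
rewrite ler_norml; apply/andP; split; lra.
Qed.

Let b x k : R := herm x k ^+ 2 / k`!%:R * expR (- x ^+ 2 / 2).

Let b_ge0 x k : 0 <= b x k.
Proof. by rewrite mulr_ge0 ?expR_ge0// divr_ge0 ?sqr_ge0. Qed.

Lemma gherm_term_bound x k : 1 <= x ->
  `|x ^+ 2 * (gherm x k ^+ 2 / gherm_norm k) * expR (- x ^+ 2 / 2) - b x k.+1| <=
  4 / x * (b x k + b x k.+1 + b x k.+2).
Proof.
move=> x1; have x0 : 0 < x by rewrite (lt_le_trans _ x1).
have rhs0 : 0 <= 4 / x * (b x k + b x k.+1 + b x k.+2).
  by rewrite mulr_ge0 ?divr_ge0 ?(ltW x0)// !addr_ge0.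
have e0 := expR_gt0 (- x ^+ 2 / 2); rewrite -(odd_double_half k) in rhs0 *.
move: (k./2) rhs0 => m; case: (odd k); rewrite ?add1n ?add0n => rhs0; last first.
  (* At even indices the two summands coincide; the error comes from the odd ones. *)
  have [g0 _] := gherm_herm x m; have [n0 _] := gherm_normE m.
  by rewrite n0 mulrA -exprMn g0 subrr normr0.
have [_ g1] := gherm_herm x m; have [_ n1] := gherm_normE m.
set K : R := m.*2.+2%:R.
have K1 : 1 <= K by rewrite ler1n.
have nf : 0 < (m.*2.+1)`!%:R :> R by rewrite ltr0n fact_gt0.
have := odd_term_bound (herm x m.*2.+1) (herm x m.*2.+2) x1 K1.
have -> : x * herm x m.*2.+2 - K * herm x m.*2.+1 = herm x m.*2.+3 by [].
have -> : x * herm x m.*2.+2 + herm x m.*2.+1 = x ^+ 2 * gherm x m.*2.+1 by [].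
have K1E : m.*2.+3%:R = K + 1 :> R by rewrite natr1.
have f2 : (m.*2.+2)`!%:R = K * (m.*2.+1)`!%:R :> R by rewrite factS natrM.
have f3 : (m.*2.+3)`!%:R = (K + 1) * (K * (m.*2.+1)`!%:R) :> R by rewrite factS natrM f2 K1E.
have {}n1 : gherm_norm m.*2.+1 = (K + 1) * (m.*2.+1)`!%:R :> R by rewrite n1 natrM K1E.
rewrite n1 /b f2 f3.
have K0 : 0 < K by rewrite (lt_le_trans _ K1).
have K10 : 0 < K + 1 by rewrite addr_gt0.
move: (m.*2.+1)`!%:R nf (gherm _ _) (herm x m.*2.+1) (herm x m.*2.+2) (herm x m.*2.+3)
  (expR _) e0 {n1 g1 rhs0 K1E f2 f3} K K1 K0 K10 => f f0 g h h' h'' E E0 K K1 K0 K10 bound.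
have Ef : 0 < E / f by rewrite divr_gt0.
have -> : x ^+ 2 * (g ^+ 2 / ((K + 1) * f)) * E - h' ^+ 2 / (K * f) * E =
    E / f * ((x ^+ 2 * g) ^+ 2 / (x ^+ 2 * (K + 1)) - h' ^+ 2 / K).
  by field; rewrite !gt_eqF.
rewrite normrM gtr0_norm//; apply: (le_trans (ler_wpM2l (ltW Ef) bound)).
rewrite le_eqVlt; apply/orP; left; apply/eqP.
by field; rewrite !gt_eqF.
Qed.

Definition gherm_sum n x : R :=
  x ^+ 2 * (\sum_(k < n.+1) gherm x k ^+ 2 / gherm_norm k) * expR (- x ^+ 2 / 2).

(** The constant is 13 = 3 * 4 + 1: three shifted sums from the termwise bound, and the term of
    order 0, which the index shift leaves unmatched and which is $x^{-2}$ times the term of order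
    1. *)
Lemma gherm_sum_bound n x : 1 <= x ->
  `|gherm_sum n x - herm_sum n.+1 x| <= 13 / x * herm_sum n.+2 x.
Proof.
move=> x1; have x0 : 0 < x by rewrite (lt_le_trans _ x1).
have bE k : \sum_(j < k.+1) b x j = herm_sum k x by [].
have -> : gherm_sum n x - herm_sum n.+1 x =
    \sum_(k < n.+1) (x ^+ 2 * (gherm x k ^+ 2 / gherm_norm k) * expR (- x ^+ 2 / 2) - b x k.+1)
    - b x 0.
  rewrite sumrB -bE big_ord_recl /gherm_sum big_distrr big_distrl /=.
  by rewrite opprD addrA addrAC.
apply: (le_trans (ler_normB _ _)); rewrite (ger0_norm (b_ge0 _ _)).
have E0 : 0 <= herm_sum n.+2 x by exact: herm_sum_ge0.
have h1 : \sum_(k < n.+1) b x k <= herm_sum n.+2 x.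
  by rewrite bE; apply: herm_sum_mono; rewrite -addn2 leq_addr.
have h2 : \sum_(k < n.+1) b x k.+1 <= herm_sum n.+2 x.
  apply: (@le_trans _ _ (herm_sum n.+1 x)); last exact: herm_sum_mono.
  by rewrite -bE [leRHS]big_ord_recl lerDr.
have h3 : \sum_(k < n.+1) b x k.+2 <= herm_sum n.+2 x.
  by rewrite -bE [leRHS]big_ord_recl [X in _ <= _ + X]big_ord_recl addrA lerDr addr_ge0.
have h4 : b x 0 <= 1 / x * herm_sum n.+2 x.
  have -> : b x 0 = b x 1 / x ^+ 2.
    by rewrite /b /herm /= fact0 -[1`!]/1%N expr1n; field; rewrite gt_eqF.
  apply: (@le_trans _ _ (b x 1 / x)).
    by rewrite ler_wpM2l// lef_pV2 ?posrE ?exprn_gt0// expr2 ler_peMr// ltW.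
  rewrite mulrC mul1r ler_wpM2l ?invr_ge0 ?(ltW x0)//.
  by rewrite -bE 2!big_ord_recl addrCA lerDl addr_ge0 ?sumr_ge0.
have -> : 13 / x * herm_sum n.+2 x = 4 / x * (herm_sum n.+2 x + herm_sum n.+2 x + herm_sum n.+2 x)
   + 1 / x * herm_sum n.+2 x by field; rewrite gt_eqF.
apply: lerD => //.
apply: (le_trans (ler_norm_sum _ _ _)).
apply: (@le_trans _ _ (\sum_(k < n.+1) (4 / x * (b x k + b x k.+1 + b x k.+2)))).
  by apply: ler_sum => k _; exact: gherm_term_bound.
rewrite -big_distrr/= ler_wpM2l ?divr_ge0 ?(ltW x0)// !big_split/=.
by rewrite !lerD.
Qed.

End KernelComparison.

(** * Limit of the density *)

Lemma cvg_sqrt (R : realType) (f : nat -> R) (a : R) :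
  f n @[n --> \oo] --> a -> Num.sqrt (f n) @[n --> \oo] --> Num.sqrt a.
Proof. by move=> fa; apply: continuous_cvg => //; exact: sqrt_continuous. Qed.

Section DensityLimit.
Context {R : realType}.
Implicit Types (n k : nat).
Variable (s : R).
Hypothesis s0 : 0 < s.

Let r n : R := 2 * Num.sqrt n%:R * s.

Let r_ge0 n : 0 <= r n.
Proof. by rewrite !mulr_ge0 ?sqrtr_ge0// ltW. Qed.

Let r_sqr n : r n ^+ 2 = 4 * n%:R * s ^+ 2.
Proof. by rewrite !exprMn sqr_sqrtr ?ler0n//; ring. Qed.

Let cvg_r : r n ^+ 2 / 4 / n%:R @[n --> \oo] --> s ^+ 2.
Proof.
apply: cvg_near_cst; near=> n.
have n0 : (n%:R : R) != 0 by rewrite pnatr_eq0 -lt0n; near: n; exact: nbhs_infty_gt.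
by rewrite r_sqr; field.
Unshelve. all: by end_near. Qed.

Let cvg_isqrt : ((Num.sqrt n%:R)^-1 : R) @[n --> \oo] --> (0 : R).
Proof.
rewrite -sqrtr0; under eq_fun do rewrite -sqrtrV ?ler0n//.
by apply: cvg_sqrt; exact: cvg_invn.
Qed.

Let cvg_ir : (r n)^-1 @[n --> \oo] --> (0 : R).
Proof.
rewrite -[X in _ --> X](mulr0 (2 * s)^-1).
under eq_fun do rewrite /r mulrAC invfM.
by apply: cvgMr; exact: cvg_isqrt.
Qed.

Let near_r_ge1 : \forall n \near \oo, 1 <= r n.
Proof.
near=> n.
have : (r n)^-1 < 1 by near: n; exact: (cvgr_lt _ cvg_ir).
have rn : 0 < r n.
  rewrite !mulr_gt0// sqrtr_gt0 ltr0n; near: n; exact: nbhs_infty_gt.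
by rewrite invf_lt1// => /ltW.
Unshelve. all: by end_near. Qed.

Let cvg_addn_divn k : (n + k)%:R / n%:R @[n --> \oo] --> (1 : R).
Proof.
have : 1 + k%:R * n%:R^-1 @[n --> \oo] --> 1 + k%:R * (0 : R).
  by apply: cvgD; [exact: cvg_cst|apply: cvgMr; exact: cvg_invn].
rewrite mulr0 addr0; apply: cvg_trans; apply: near_eq_cvg; near=> n.
have n0 : (n%:R : R) != 0 by rewrite pnatr_eq0 -lt0n; near: n; exact: nbhs_infty_gt.
by rewrite natrD; field.
Unshelve. all: by end_near. Qed.

Let sqrt_herm_sum N n x : herm_sum N x / Num.sqrt n%:R = Num.sqrt (herm_sum N x ^+ 2 / n%:R) :> R.
Proof.
by rewrite sqrtrM ?sqr_ge0// sqrtr_sqr ger0_norm ?herm_sum_ge0// sqrtrV ?ler0n.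
Qed.

Lemma cvg_herm_sum_lt1 k : s < 1 ->
  herm_sum (n + k) (r n) / Num.sqrt n%:R @[n --> \oo] --> Num.sqrt (2 / pi * (1 - s ^+ 2)).
Proof.
move=> s1; under eq_fun do rewrite sqrt_herm_sum.
apply: cvg_sqrt.
apply: cvg_herm_sum => //; first exact: sqr_ge0.
by rewrite expr_lt1// ltW.
Qed.

Lemma cvg_herm_sum_gt1 k : 1 < s ->
  herm_sum (n + k) (r n) / Num.sqrt n%:R @[n --> \oo] --> (0 : R).
Proof.
move=> s1; under eq_fun do rewrite sqrt_herm_sum.
rewrite -sqrtr0; apply: cvg_sqrt.
apply/cvgrPdist_le => eps eps0.
have pi0 := pi_gt0 R.
(* Chosen so that the limit [2 / pi * (nu - s ^+ 2)] for the larger index is [eps / 2]. *)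
pose nu := s ^+ 2 + pi / 4 * eps.
have s2 : 1 < s ^+ 2 by rewrite exprn_egt1.
have nus : s ^+ 2 < nu by rewrite ltrDl mulr_gt0// divr_gt0.
have nu1 : 1 < nu by rewrite (lt_trans s2).
(* [N n >= nu * n] with [nu > 1], so [N n] eventually exceeds [n + k] for the fixed [k]. *)
pose N n := (Num.trunc (nu * n%:R)).+1.
have Nb n : nu * n%:R <= (N n)%:R <= nu * n%:R + 1.
  have /andP[h1 h2] : (Num.trunc (nu * n%:R))%:R <= nu * n%:R < (N n)%:R.
    by apply: truncn_itv; rewrite mulr_ge0// ltW// (lt_trans ltr01).
  by rewrite (ltW h2) /N -natr1 lerD2r.
have Nnu : (N n)%:R / n%:R @[n --> \oo] --> nu.
  have h : nu + n%:R^-1 @[n --> \oo] --> nu.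
    by rewrite -[X in _ --> X]addr0; apply: cvgD; [exact: cvg_cst|exact: cvg_invn].
  apply: (squeeze_cvgr _ (cvg_cst nu) h); near=> n.
  have n0 : 0 < n%:R :> R by rewrite ltr0n; near: n; exact: nbhs_infty_gt.
  have /andP[b1 b2] := Nb n.
  rewrite /= ler_pdivlMr// b1 ler_pdivrMr//.
  by rewrite (_ : (nu + n%:R^-1) * n%:R = nu * n%:R + 1)//; field; rewrite gt_eqF.
have := cvg_herm_sum r_ge0 (sqr_ge0 s) nus Nnu cvg_r.
have -> : 2 / pi * (nu - s ^+ 2) = eps / 2.
  by rewrite /nu; move: (@pi R) pi0 => p p0; field; rewrite gt_eqF.
move=> cE; near=> n.
have n0 : 0 < n%:R :> R by rewrite ltr0n; near: n; exact: nbhs_infty_gt.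
rewrite sub0r normrN ger0_norm ?divr_ge0 ?sqr_ge0//.
have lt : herm_sum (N n) (r n) ^+ 2 / n%:R < eps.
  by near: n; apply: (cvgr_lt _ cE); rewrite ltr_pdivrMr// mulr2n mulrDr mulr1 ltrDl.
apply: (le_trans _ (ltW lt)); rewrite ler_wpM2r ?invr_ge0 ?(ltW n0)//.
rewrite ler_sqr ?nnegrE ?herm_sum_ge0//; apply: herm_sum_mono.
rewrite -(ler_nat R); have /andP[h _] := Nb n; apply: le_trans h.
have : k%:R * n%:R^-1 < nu - 1.
  near: n; have ck : k%:R * n%:R^-1 @[n --> \oo] --> (0 : R).
    by rewrite -[X in _ --> X](mulr0 k%:R); apply: cvgMr; exact: cvg_invn.
  by apply: (cvgr_lt _ ck); rewrite subr_gt0.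
by rewrite ltr_pdivrMr// natrD; lra.
Unshelve. all: by end_near. Qed.

Let cvg_gherm_sum (L : R) :
  (forall k, herm_sum (n + k) (r n) / Num.sqrt n%:R @[n --> \oo] --> L) ->
  gherm_sum n (r n) / Num.sqrt n%:R @[n --> \oo] --> L.
Proof.
move=> EL.
have err : 13 * ((r n)^-1 * (herm_sum (n + 2) (r n) / Num.sqrt n%:R)) @[n --> \oo] --> (0 : R).
  by rewrite -[X in _ --> X](mulr0 13) -[X in _ * X](mul0r L); apply: cvgMr; apply: cvgM.
have lo : herm_sum (n + 1) (r n) / Num.sqrt n%:R
   - 13 * ((r n)^-1 * (herm_sum (n + 2) (r n) / Num.sqrt n%:R)) @[n --> \oo] --> L.
  by rewrite -[X in _ --> X]subr0; exact: cvgB.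
have up : herm_sum (n + 1) (r n) / Num.sqrt n%:R
   + 13 * ((r n)^-1 * (herm_sum (n + 2) (r n) / Num.sqrt n%:R)) @[n --> \oo] --> L.
  by rewrite -[X in _ --> X]addr0; exact: cvgD.
apply: (squeeze_cvgr _ lo up); near=> n.
have r1 : 1 <= r n by near: n.
have := gherm_sum_bound n r1; rewrite ler_norml -(addn2 n) -(addn1 n) => /andP[h1 h2].
have i0 : 0 <= (Num.sqrt n%:R)^-1 :> R by rewrite invr_ge0 sqrtr_ge0.
have := ler_wpM2r i0 h1; have := ler_wpM2r i0 h2.
move: (Num.sqrt _)^-1 (herm_sum _ _) (herm_sum _ _) (gherm_sum _ _) (r n)^-1 => i a b g j.
move=> H1 H2; apply/andP; split; lra.
Unshelve. all: by end_near. Qed.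

(** [gherm_sum] contains the factor [r n ^+ 2 = 4 * n * s ^+ 2]; dividing it out turns the prefactor
    $2\sqrt n$ into $1/(2 s^2 \sqrt n)$. *)
Let scaled_rho P u n : monic_orthogonal P -> qre u = 0 -> qnorm u = 1 -> (0 < n)%N ->
  2 * Num.sqrt n%:R * rho P n (r n *: u) =
  (Num.sqrt (2 * pi))^-1 ^+ 3 / (2 * s ^+ 2) * (gherm_sum n (r n) / Num.sqrt n%:R).
Proof.
move=> hP u0 u1 n0; rewrite rho_gherm// powR_2pi /gherm_sum mulNr.
have q0 : 0 < Num.sqrt n%:R :> R by rewrite sqrtr_gt0 ltr0n.
move: (_^-1 ^+ 3) (\sum_(_ < _) _) (expR _) => C S E; rewrite /r.
by field; rewrite !gt_eqF.
Qed.

Lemma cvg_scaled_rho P u (L : R) : monic_orthogonal P -> qre u = 0 -> qnorm u = 1 ->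
  (forall k, herm_sum (n + k) (r n) / Num.sqrt n%:R @[n --> \oo] --> L) ->
  2 * Num.sqrt n%:R * rho P n ((2 * Num.sqrt n%:R * s) *: u) @[n --> \oo] -->
  (Num.sqrt (2 * pi))^-1 ^+ 3 / (2 * s ^+ 2) * L.
Proof.
move=> hP u0 u1 EL.
have h : (Num.sqrt (2 * pi))^-1 ^+ 3 / (2 * s ^+ 2) * (gherm_sum n (r n) / Num.sqrt n%:R)
    @[n --> \oo] --> (Num.sqrt (2 * pi))^-1 ^+ 3 / (2 * s ^+ 2) * L.
  by apply: cvgMr; exact: cvg_gherm_sum.
apply: cvg_trans h; apply: near_eq_cvg; near=> n.
by apply/esym/scaled_rho => //; near: n; exact: nbhs_infty_gt.
Unshelve. all: by end_near. Qed.

End DensityLimit.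

Theorem mainTheorem13 (R : realType) (P : nat -> {poly quat R})
    (hP : monic_orthogonal P) (u : quat R) (hu_pure : qre u = 0)
    (hu_unit : qnorm u = 1) (s : R) (hs : 0 < s) :
  (s < 1 ->
    (fun n : nat => 2 * Num.sqrt n%:R * rho P n ((2 * Num.sqrt n%:R * s) *: u))
      @ \oo --> limit_density s) /\
  (1 < s ->
    (fun n : nat => 2 * Num.sqrt n%:R * rho P n ((2 * Num.sqrt n%:R * s) *: u))
      @ \oo --> (0 : R)).
Proof.
split=> [s1|s1]; last first.
  rewrite -(mulr0 ((Num.sqrt (2 * pi))^-1 ^+ 3 / (2 * s ^+ 2))).
  by apply: cvg_scaled_rho => // k; exact: cvg_herm_sum_gt1.
have -> : limit_density s =
    (Num.sqrt (2 * pi))^-1 ^+ 3 / (2 * s ^+ 2) * Num.sqrt (2 / pi * (1 - s ^+ 2)).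
  rewrite /limit_density.
  have pi0 := pi_gt0 R.
  have q0 : 0 < Num.sqrt (2 * pi) :> R by rewrite sqrtr_gt0 mulr_gt0.
  rewrite [Num.sqrt (2 / pi * _)]sqrtrM ?divr_ge0 ?(ltW pi0)//.
  (* This factor turns $(2\pi)^{-3/2}/2$ into $(2\pi)^{-2}$. *)
  have -> : Num.sqrt (2 / pi) = Num.sqrt (2 * pi) / pi :> R.
    apply/eqP; rewrite -(@eqrXn2 _ 2)// ?divr_ge0 ?sqrtr_ge0 ?(ltW pi0)//.
    rewrite sqr_sqrtr ?divr_ge0 ?(ltW pi0)// expr_div_n sqr_sqrtr ?mulr_ge0 ?(ltW pi0)//.
    by move: (@pi R) pi0 => p p0; apply/eqP; field; rewrite gt_eqF.
  have qq : Num.sqrt (2 * pi) ^+ 2 = 2 * pi :> R by rewrite sqr_sqrtr ?mulr_ge0 ?(ltW pi0).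
  move: (Num.sqrt (2 * pi)) q0 qq (Num.sqrt (1 - _)) => q q0 qq t; rewrite -qq.
  move: (@pi R) pi0 qq => p p0 qq.
  have -> : p = q ^+ 2 / 2 by rewrite qq mulrAC divff ?mul1r.
  by field; rewrite !gt_eqF.
by apply: cvg_scaled_rho => // k; exact: cvg_herm_sum_lt1.
Qed.
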